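(* There exists an absolute constant $C > 0$ such that for all integers $n$ and $k$ with $k \ge 2$ and $n \ge C k^4 \log k$, and for every family $\mathcal{F} \subseteq 2^{[n]}$, the number of $(2,k)$-colourings of $\mathcal{F}$ is at most $2^{m_{k-1}}$. Moreover, we have equality if and only if $\mathcal{F}$ is a $k$-chain-free family of maximum size (among all $k$-chain-free subfamilies of $2^{[n]}$).
   Context: $[n] = \{1,\dots,n\}$ and $2^{[n]}$ is the family of all subsets of $[n]$. Logarithms are binary. A $k$-chain is a collection of $k$ distinct sets $F_1 \subset F_2 \subset \cdots \subset F_k$ (strict containments); a family is $k$-chain-free if it contains no $k$-chain. Given a family $\mathcal{F} \subseteq 2^{[n]}$, an $(r,k)$-colouring of $\mathcal{F}$ is an $r$-colouring of the sets in $\mathcal{F}$ (a map from $\mathcal{F}$ to a fixed set of $r$ colours, not necessarily surjective) such that there is no monochromatic $k$-chain consisting of members of $\mathcal{F}$. The number $m_{k-1}$ (depending on $n$) is the total size of the $k-1$ largest uniform levels of $2^{[n]}$: \[ m_{k-1} = \sum_{i = \lfloor (n-k+2)/2 \rfloor}^{\lfloor (n+k-2)/2 \rfloor} \binom{n}{i}. \] *)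

(* Defs.v *)
From HB Require Import structures.
From mathcomp Require Import all_boot all_order all_algebra.
From mathcomp Require Import reals exp.

Set Implicit Arguments.
Unset Strict Implicit.
Unset Printing Implicit Defensive.

Import Order.TTheory GRing.Theory Num.Theory.

Local Open Scope nat_scope.

(* The ground set [n] is represented by 'I_n. A k-chain is enumerated in
   increasing order, which makes its k members distinct. *)
Definition is_chain n k (s : k.-tuple {set 'I_n}) : bool :=
  sorted (fun A B : {set 'I_n} => A \proper B) s.

Definition chain_free n k (F : {set {set 'I_n}}) : bool :=
  ~~ [exists s : k.-tuple {set 'I_n}, is_chain s && all [in F] s].

Definition max_chain_free n k (F : {set {set 'I_n}}) : Prop :=
  chain_free k F /\
  forall G : {set {set 'I_n}}, chain_free k G -> #|G| <= #|F|.

Definition member n (F : {set {set 'I_n}}) := {A : {set 'I_n} | A \in F}.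

Definition is_colouring n r k (F : {set {set 'I_n}})
    (c : {ffun member F -> 'I_r}) : bool :=
  ~~ [exists s : k.-tuple (member F),
        is_chain [tuple of map val s] && constant (map c s)].

Definition num_colourings n r k (F : {set {set 'I_n}}) : nat :=
  #|[set c : {ffun member F -> 'I_r} | is_colouring k c]|.

(* For k >= 2 this is m_{k-1}. When n < k - 2 the lower index is truncated to
   0, which is harmless since the binomial coefficients of negative lower index
   vanish. *)
Definition middle_levels_size n k : nat :=
  \sum_((n + 2 - k) %/ 2 <= i < ((n + k - 2) %/ 2).+1) 'C(n, i).

Definition log2 (R : realType) (x : R) : R := (ln x / ln 2%:R)%R.

(* Main.v *)
(* Identify a colouring of F with its set R of red members, and let R be uniform
   among the N valid ones. Reveal the colours in order of cardinality. For each
   set A let s(A), t(A) be the lengths of the longest red and blue chains strictly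
   below A. For A < B consecutive in F on a maximal chain, say that they are in
   conflict if s(A) >= s(B) or t(A) >= t(B). Then the pair (s(B), t(B)) and the
   colours below A determine the colour of A. As s + t grows by 2 at each step
   without conflict and never exceeds 2k - 2, a chain meeting F in k - 1 + x sets
   has at least 2x conflicts.

   By the chain rule log2 N is the sum of the conditional entropies of the colours,
   which LYM weights turn into an average over a random maximal chain. Conflicts
   therefore gain twice what the excess x costs. Revealing (s(B), t(B)) costs at
   most 2 log2 k bits. These are shared by all sets below B, so the cost
   is only O(log k / n) in terms of the weight of B. It is paid for at the sets B
   where conflicts are not too rare. At every other B both heights take a
   typical value with probability close to 1, also for the chains
   above B, and conflicts are detected by assuming the typical value. The upward
   and downward versions are averaged. The result is
     log2 N <= m - c E|x|,
   so N < 2^m unless every maximal chain meets F in exactly k - 1 sets. *)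

Require Import Defs.
From mathcomp Require Import all_boot all_order all_algebra all_fingroup.
From mathcomp Require Import reals exp.
From mathcomp Require Import ring lra zify.

Set Implicit Arguments.
Unset Strict Implicit.
Unset Printing Implicit Defensive.

Import Order.TTheory GRing.Theory Num.Theory.

(** Heights are typical because two independent quantities mostly agree. The position of B in the
    trace depends only on the chain, the height of B in its own colour only on the colouring. On a
    chain with k - 1 members they are equal unless some height falls short of the position, below B
    or above it, and this requires a conflict. If conflicts are rare, both quantities are therefore
    nearly constant. Conflicts above B are those of the complemented family, and each direction
    rewards only its own conflicts; hence the average of the two.

    Rarity of conflicts only prevents heights from being too small. Where a height is often too
    large, the colour of B itself becomes predictable, which is a separate gain.

    Guessing loses up to 7 zeta per member and a chain has at most 2k - 2 members, so zeta of order
    1/k keeps the total loss small against the excess, an integer. As conflicts return almost twice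
    the excess, a fixed share of the gain is left to pay for the revealed heights. *)

Section Log2.
Local Open Scope ring_scope.
Variable R : realType.
Implicit Types x y : R.

Lemma ln2_gt0 : 0 < ln (2 : R).
Proof. by apply: ln_gt0; lra. Qed.

Lemma ln_leB1 x : 0 < x -> ln x <= x - 1.
Proof.
move=> x0; have -> : ln x = ln (1 + (x - 1)) by congr ln; ring.
by apply: le_ln1Dx; lra.
Qed.

Lemma ln2_ge_half : 2^-1 <= ln (2 : R).
Proof.
have h : ln ((2 : R)^-1) <= 2^-1 - 1 by apply: ln_leB1; lra.
by rewrite lnV ?posrE // in h; lra.
Qed.

Lemma log2_1 : log2 (1 : R) = 0.
Proof. by rewrite /log2 ln1 mul0r. Qed.

Lemma log2_2 : log2 (2 : R) = 1.
Proof. by rewrite /log2 divff // gt_eqF // ln2_gt0. Qed.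

Lemma log2M x y : 0 < x -> 0 < y -> log2 (x * y) = log2 x + log2 y.
Proof. by move=> x0 y0; rewrite /log2 lnM ?posrE // mulrDl. Qed.

Lemma log2V x : 0 < x -> log2 x^-1 = - log2 x.
Proof. by move=> x0; rewrite /log2 lnV ?posrE // mulNr. Qed.

Lemma log2_div x y : 0 < x -> 0 < y -> log2 (x / y) = log2 x - log2 y.
Proof. by move=> x0 y0; rewrite log2M ?invr_gt0 // log2V. Qed.

Lemma log2X x n : 0 < x -> log2 (x ^+ n) = n%:R * log2 x.
Proof. by move=> x0; rewrite /log2 lnXn // -[ln x *+ n]mulr_natl mulrA. Qed.

Lemma log2_le x y : 0 < x -> 0 < y -> (log2 x <= log2 y) = (x <= y).
Proof.
move=> x0 y0; rewrite /log2 ler_pM2r ?invr_gt0 ?ln2_gt0 //.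
by rewrite ler_ln ?posrE.
Qed.

Lemma log2_ge1 (k : nat) : (2 <= k)%N -> 1 <= log2 (k%:R : R).
Proof.
move=> k2; have k0 : 0 < k%:R :> R by rewrite ltr0n (leq_trans _ k2).
have := @log2_le 2 k%:R _ k0; rewrite log2_2 => -> //; by rewrite ?ler_nat ?ltr0n.
Qed.

End Log2.

(** * Conditional entropy *)

Section Entropy.
Local Open Scope ring_scope.
Variables (R : realType) (W : finType) (Om : {set W}).
Hypothesis Om_gt0 : (0 < #|Om|)%N.

Definition avg (f : W -> R) : R := #|Om|%:R^-1 * \sum_(w in Om) f w.

Let N0 : 0 < #|Om|%:R :> R. Proof. by rewrite ltr0n. Qed.

Lemma le_avg (f g : W -> R) : {in Om, forall w, f w <= g w} -> avg f <= avg g.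
Proof.
by move=> fg; rewrite /avg ler_pM2l ?invr_gt0 //; apply: ler_sum.
Qed.

Lemma eq_avg (f g : W -> R) : {in Om, f =1 g} -> avg f = avg g.
Proof. by move=> fg; congr (_ * _); apply: eq_bigr. Qed.

Lemma avg_ge0 (f : W -> R) : {in Om, forall w, 0 <= f w} -> 0 <= avg f.
Proof. by move=> f0; rewrite mulr_ge0 ?invr_ge0 ?ler0n // sumr_ge0. Qed.

Lemma avgD f g : avg (fun w => f w + g w) = avg f + avg g.
Proof. by rewrite /avg big_split mulrDr. Qed.

Lemma avgZ a f : avg (fun w => a * f w) = a * avg f.
Proof. by rewrite /avg -mulr_sumr mulrCA. Qed.

Lemma avgB f g : avg (fun w => f w - g w) = avg f - avg g.
Proof. by rewrite /avg sumrB mulrBr. Qed.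

Lemma avg_cst a : avg (fun=> a) = a.
Proof.
by rewrite /avg sumr_const -[a *+ _]mulr_natl mulrA mulVf ?mul1r // gt_eqF.
Qed.

Lemma avg_sum (I : finType) (P : pred I) (f : I -> W -> R) :
  avg (fun w => \sum_(i | P i) f i w) = \sum_(i | P i) avg (f i).
Proof. by rewrite /avg exchange_big mulr_sumr. Qed.

Lemma exists_avg_le (f : W -> R) : exists2 w, w \in Om & f w <= avg f.
Proof.
case: (boolP [exists w in Om, f w <= avg f]) => [/existsP[w /andP[]]|]; first by exists w.
rewrite negb_exists => /forallP nle.
have : avg (fun=> avg f) < avg f.
  rewrite {1}/avg [in X in _ < X]/avg ltr_pM2l ?invr_gt0 //; apply: ltr_sum.
    by move/card_gt0P: Om_gt0 => [w wO]; apply/hasP; exists w; rewrite ?mem_index_enum.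
  by move=> w wO; have := nle w; rewrite wO /= -ltNge.
by rewrite avg_cst ltxx.
Qed.

Definition fiber (S : eqType) (Y : W -> S) w := #|[set w' in Om | Y w' == Y w]|.

Lemma fiber_gt0 (S : eqType) (Y : W -> S) w : w \in Om -> (0 < fiber Y w)%N.
Proof. by move=> wO; apply/card_gt0P; exists w; rewrite inE wO eqxx. Qed.

Lemma eq_fiber (S S' : eqType) (Y : W -> S) (Z : W -> S') w : w \in Om ->
  {in Om &, forall w w', (Y w == Y w') = (Z w == Z w')} -> fiber Y w = fiber Z w.
Proof.
move=> wO YZ; apply: eq_card => w'; rewrite !inE.
by case: (boolP (w' \in Om)) => //= w'O; rewrite YZ.
Qed.

(* H(b | Y) in bits for the uniform distribution on [Om], expressed through the
   sizes of the fibres. *)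
Definition cond_entropy (S : eqType) (Y : W -> S) (b : W -> bool) : R :=
  avg (fun w => log2 (fiber Y w)%:R - log2 (fiber (fun w => (Y w, b w)) w)%:R).

Lemma sum_fiber (S : eqType) (Y : W -> S) w (a : R) : 0 <= a ->
  \sum_(w' in Om | Y w' == Y w) a / (fiber Y w')%:R <= a.
Proof.
move=> a0; rewrite (eq_bigr (fun=> a / (fiber Y w)%:R)); last first.
  move=> w' /andP[_ /eqP e]; suff -> : fiber Y w' = fiber Y w by [].
  by apply: eq_card => v; rewrite !inE e.
rewrite sumr_const.
have -> : #|[pred w' in Om | Y w' == Y w]| = fiber Y w.
  by apply: eq_card => v; rewrite !inE.
case: (fiber Y w) => [|m]; first by rewrite mulr0n.
by rewrite -[X in X <= _]mulr_natr -mulrA mulVf ?mulr1 // pnatr_eq0.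
Qed.

(** Coding with [q] cannot beat the entropy: the ratio [r] of [q] to the true conditional
    probability has mean at most 1, and ln r <= r - 1. The upper bounds on conditional entropies
    below all come from a choice of [q]. *)
Lemma gibbs (S : eqType) (Y : W -> S) (b : W -> bool) (q : W -> bool -> R) :
  (forall w c, 0 <= q w c) -> (forall w, q w true + q w false <= 1) ->
  {in Om &, forall w w', Y w = Y w' -> q w =1 q w'} ->
  {in Om, forall w, 0 < q w (b w)} ->
  cond_entropy Y b <= avg (fun w => - log2 (q w (b w))).
Proof.
move=> q_ge0 q_le1 qY q_gt0.
pose Z w := (Y w, b w).
rewrite -subr_ge0 -avgB /avg mulr_ge0 ?invr_ge0 ?ler0n //.
pose r w : R := (fiber Y w)%:R * q w (b w) / (fiber Z w)%:R.
have fY w : w \in Om -> 0 < (fiber Y w)%:R :> R by move=> wO; rewrite ltr0n fiber_gt0.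
have fZ w : w \in Om -> 0 < (fiber Z w)%:R :> R by move=> wO; rewrite ltr0n fiber_gt0.
have sum_r : \sum_(w in Om) r w <= #|Om|%:R.
  have -> : \sum_(w in Om) r w =
    \sum_(w in Om) \sum_(w' in Om | Y w' == Y w) q w' (b w) / (fiber Z w)%:R.
    apply: eq_bigr => w wO.
    rewrite (eq_bigr (fun=> q w (b w) / (fiber Z w)%:R)); last first.
      by move=> w' /andP[w'O /eqP e]; rewrite (qY _ _ w'O wO e).
    rewrite sumr_const /r -mulrA -[RHS]mulr_natl.
    suff -> : #|[pred w' in Om | Y w' == Y w]| = fiber Y w by [].
    by apply: eq_card => v; rewrite !inE.
  rewrite (exchange_big_dep (mem Om)) /=; last by move=> i j _ /andP[].
  rewrite -sumr_const; apply: ler_sum => w wO.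
  apply: le_trans (q_le1 w).
  (* Inside a fibre of [Y], each value [c] of [b] is one fibre of [Z], with total at most [q w c];
     [v] is a representative of it. *)
  rewrite (bigID b) /=; apply: lerD.
    case: (pickP [pred v in Om | (Y w == Y v) && b v]) => [v /=|no].
      move=> /and3P[vO /eqP wv bv].
      apply: le_trans (sum_fiber Z v (q_ge0 w true)).
      rewrite le_eqVlt; apply/orP; left; apply/eqP; apply: eq_big => u.
        rewrite wO /Z xpair_eqE bv; case: (u \in Om) => //=.
        by rewrite -wv eq_sym eqb_id.
      by move=> /andP[_ bu]; rewrite bu.
    rewrite big_pred0 //= => v; apply/negbTE; move: (no v) => /= /negbT.
    by apply: contra => /andP[/and3P[-> _ ->] ->].
  case: (pickP [pred v in Om | (Y w == Y v) && ~~ b v]) => [v /=|no].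
    move=> /and3P[vO /eqP wv bv].
    apply: le_trans (sum_fiber Z v (q_ge0 w false)).
    rewrite le_eqVlt; apply/orP; left; apply/eqP; apply: eq_big => u.
      rewrite wO /Z xpair_eqE (negbTE bv); case: (u \in Om) => //=.
      by rewrite -wv eq_sym eqbF_neg.
    by move=> /andP[_ bu]; rewrite (negbTE bu).
  rewrite big_pred0 //= => v; apply/negbTE; move: (no v) => /= /negbT.
  by apply: contra => /andP[/and3P[-> _ ->] ->].
have sum_ln : \sum_(w in Om) ln (r w) <= 0.
  apply: (@le_trans _ _ (\sum_(w in Om) (r w - 1))).
    apply: ler_sum => w wO; apply: ln_leB1.
    by rewrite /r !mulr_gt0 ?invr_gt0 ?fY ?fZ ?q_gt0.
  by rewrite sumrB sumr_const subr_le0.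
have -> : \sum_(w in Om) (- log2 (q w (b w)) -
      (log2 (fiber Y w)%:R - log2 (fiber Z w)%:R)) =
    - ((\sum_(w in Om) ln (r w)) / ln 2).
  rewrite mulr_suml -sumrN; apply: eq_bigr => w wO.
  rewrite -[ln (r w) / _]/(log2 (r w)) /r.
  rewrite log2_div ?mulr_gt0 ?fY ?fZ ?q_gt0 // log2M ?fY ?q_gt0 //; ring.
by rewrite oppr_ge0 pmulr_lle0 // invr_gt0 ln2_gt0.
Qed.

(** Gibbs with [q] the true conditional probability given [Y] alone, which is also a function of the
    finer observation. *)
Lemma cond_entropy_drop (S T : eqType) (Y : W -> S) (Z : W -> T) (b : W -> bool) :
  cond_entropy (fun w => (Y w, Z w)) b <= cond_entropy Y b.
Proof.
pose q w c : R := #|[set v in Om | (Y v == Y w) && (b v == c)]|%:R / (fiber Y w)%:R.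
have qE w : w \in Om -> q w (b w) = (fiber (fun w => (Y w, b w)) w)%:R / (fiber Y w)%:R.
  move=> wO; rewrite /q; suff -> : #|[set v in Om | (Y v == Y w) && (b v == b w)]| =
    fiber (fun w => (Y w, b w)) w by [].
  by apply: eq_card => v; rewrite !inE.
have -> : cond_entropy Y b = avg (fun w => - log2 (q w (b w))).
  apply: eq_avg => w wO; rewrite qE // log2_div ?ltr0n ?fiber_gt0 //; ring.
apply: gibbs.
- by move=> w c; rewrite divr_ge0 ?ler0n.
- move=> w; rewrite /q -mulrDl -natrD.
  have -> : (#|[set v in Om | (Y v == Y w) && (b v == true)]| +
     #|[set v in Om | (Y v == Y w) && (b v == false)]|)%N = fiber Y w.
    rewrite /fiber -(cardsID [set v | b v] [set v in Om | Y v == Y w]); congr addn.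
      by apply: eq_card => v; rewrite !inE eqb_id; case: (b v); rewrite ?andbF ?andbT.
    by apply: eq_card => v; rewrite !inE eqbF_neg; case: (b v); rewrite ?andbF ?andbT.
  case: (fiber Y w) => [|m]; first by rewrite mul0r.
  by rewrite divff // pnatr_eq0.
- move=> w w' wO w'O [e _] c; rewrite /q /fiber.
  by rewrite e.
- by move=> w wO; rewrite qE // divr_gt0 ?ltr0n ?fiber_gt0.
Qed.


(** The left-hand side is the entropy of [Y], largest for the uniform distribution on [S]. *)
Lemma log2_fiber_le (S : finType) (Y : W -> S) :
  log2 #|Om|%:R - avg (fun w => log2 (fiber Y w)%:R) <= log2 #|S|%:R.
Proof.
have [w0 w0O] : exists w, w \in Om by apply/card_gt0P.
have S0 : 0 < #|S|%:R :> R by rewrite ltr0n; apply/card_gt0P; exists (Y w0).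
pose r w : R := #|Om|%:R / (fiber Y w)%:R / #|S|%:R.
have r0 w : w \in Om -> 0 < r w.
  by move=> wO; rewrite /r !divr_gt0 // ltr0n fiber_gt0.
have sum_inv : \sum_(w in Om) (fiber Y w)%:R^-1 <= #|S|%:R :> R.
  rewrite (partition_big Y xpredT) //= -sum1_card natr_sum; apply: ler_sum => y _.
  case: (pickP [pred w in Om | Y w == y]) => [w /andP[wO /eqP <-]|no].
    apply: le_trans (sum_fiber Y w ler01); apply: ler_sum => v _.
    by rewrite div1r.
  by rewrite big_pred0.
suff : avg (fun w => log2 (r w)) <= 0.
  have -> : avg (fun w => log2 (r w)) =
    log2 #|Om|%:R - avg (fun w => log2 (fiber Y w)%:R) - log2 #|S|%:R.
    rewrite -[X in X - _ - _]avg_cst -[X in _ - X]avg_cst -!avgB; apply: eq_avg => w wO.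
    by rewrite /r !log2_div ?divr_gt0 // ltr0n fiber_gt0.
  by rewrite subr_le0.
have -> : avg (fun w => log2 (r w)) = avg (fun w => ln (r w)) / ln 2.
  by rewrite /avg -mulrA mulr_suml.
rewrite pmulr_lle0 ?invr_gt0 ?ln2_gt0 //.
apply: (@le_trans _ _ (avg (fun w => r w - 1))).
  by apply: le_avg => w wO; apply: ln_leB1; apply: r0.
rewrite avgB avg_cst subr_le0 /avg -mulr_suml.
rewrite (eq_bigr (fun w => #|Om|%:R * (fiber Y w)%:R^-1)) // -mulr_sumr.
rewrite mulrA mulrA mulVf ?gt_eqF // mul1r ler_pdivrMr // mul1r //.
Qed.

End Entropy.

(** * Heights in a family of sets *)

Section Height.
Variable T : finType.
Implicit Types (A B : {set T}) (G : {set {set T}}).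

(** The argument [m] is fuel: proper subsets are smaller, so any [m] from #|A| on gives the same
    value. *)
Fixpoint height_rec G m A :=
  if m is m'.+1 then \max_(B in G | B \proper A) (height_rec G m' B).+1 else 0.

(* The length of a longest chain of [G] strictly below [A]. *)
Definition height G A := height_rec G #|A| A.

Lemma height_rec_stable G m m' A :
  #|A| <= m -> #|A| <= m' -> height_rec G m A = height_rec G m' A.
Proof.
have base p B : #|B| <= 0 -> height_rec G p B = 0.
  rewrite leqn0 cards_eq0 => /eqP ->; case: p => //= p.
  rewrite big1 // => C /andP[_]; by rewrite properE subset0 => /andP[/eqP-> ]; rewrite sub0set.
elim: m m' A => [|m IH] m' A Am Am'; first by rewrite !base.
case: m' Am' => [|m'] Am'; first by rewrite !base.
rewrite /=; apply: eq_bigr => B /andP[_ /proper_card BA]; congr _.+1.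
by apply: IH; rewrite -ltnS; apply: leq_trans BA _.
Qed.

Lemma heightE G A : height G A = \max_(B in G | B \proper A) (height G B).+1.
Proof.
have -> : height G A = height_rec G #|A|.+1 A by apply: height_rec_stable.
apply: eq_bigr => B /andP[_ /proper_card/ltnW BA]; congr _.+1.
exact: height_rec_stable.
Qed.

Lemma height_lt G A B : B \in G -> B \proper A -> height G B < height G A.
Proof. by move=> BG BA; rewrite [X in _ < X]heightE (bigop.bigmax_sup B) ?BG. Qed.

Lemma height_pred G A : 0 < height G A ->
  exists B, [/\ B \in G, B \proper A & height G A = (height G B).+1].
Proof.
rewrite heightE => h.
case: (pickP [pred B in G | B \proper A]) => [B0 B0P|no]; last first.
  by rewrite big_pred0 in h.
have c0 : 0 < #|[pred B in G | B \proper A]| by apply/card_gt0P; exists B0.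
have [B /andP[BG BA] e] := bigop.eq_bigmax_cond (fun B => (height G B).+1) c0.
by exists B; split.
Qed.

Lemma eq_height G G' A :
  (forall B, B \proper A -> (B \in G) = (B \in G')) -> height G A = height G' A.
Proof.
move: {2}#|A| (leqnn #|A|) => m; elim: m A => [|m IH] A Am GG'; rewrite !heightE.
  rewrite !big1 // => B /andP[_ /proper_card]; lia.
apply: eq_big => [B|B /andP[BG BA]].
  by case: (boolP (B \proper A)) => BA; rewrite ?andbF // GG'.
congr _.+1; apply: IH; first by have := proper_card BA; lia.
by move=> C CB; apply: GG'; apply: proper_trans CB BA.
Qed.

Lemma height_leq_card G lo A :
  (forall B, B \in G -> lo <= #|B|) -> lo <= #|A| -> height G A <= #|A| - lo.
Proof.
move=> Glo; move: {2}#|A| (leqnn #|A|) => m.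
elim: m A => [|m IH] A Am loA; case: (posnP (height G A)) => [-> //|] /height_pred.
  by move=> [B [_ /proper_card BA _]]; lia.
move=> [B [BG /proper_card BA ->]].
have := IH B; have := Glo B BG; lia.
Qed.

Definition dual G : {set {set T}} := [set ~: A | A in G].

Lemma in_dual G A : (~: A \in dual G) = (A \in G).
Proof. exact: mem_imset (@setC_inj T). Qed.

Lemma properC A B : (~: A \proper ~: B) = (B \proper A).
Proof. by rewrite !properE !setCS. Qed.

(** [height (dual G) (~: A)] is the length of a longest chain of [G] strictly above [A]. Climbing
    such a chain raises the height by at least 1 per step. *)
Lemma height_dual_add G A : A \in G ->
  exists2 B, B \in G & height G A + height (dual G) (~: A) <= height G B.
Proof.
move: {2}(height _ _) (erefl (height (dual G) (~: A))) => j.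
elim: j A => [|j IH] A ej AG; first by exists A; rewrite ?ej ?addn0.
have /height_pred[B' [B'G B'A e]] : 0 < height (dual G) (~: A) by rewrite ej.
pose B := ~: B'; have eB : B' = ~: B by rewrite setCK.
move: B'G B'A e; rewrite eB in_dual properC => BG AB; rewrite ej => -[e].
have [C CG le_C] := IH B (esym e) BG; exists C => //.
by apply: leq_trans le_C; rewrite -e; have := height_lt AG AB; lia.
Qed.

End Height.

(** * Chain-freeness in terms of heights *)

Section Valid.
Variables n k : nat.
Implicit Types (A B : {set 'I_n}) (G : {set {set 'I_n}}).

Definition low_heights G := [forall A in G, (height G A).+1 < k].

Lemma path_height G A s : A \in G -> all [in G] s ->
  path (fun A B : {set 'I_n} => A \proper B) A s ->
  height G A + size s <= height G (last A s).
Proof.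
elim: s A => [|B s IH] A AG /=; first by rewrite addn0.
move=> /andP[BG sG] /andP[AB ps]; apply: leq_trans (IH B BG sG ps).
by rewrite addnS -addSn leq_add2r height_lt.
Qed.

Lemma height_chain G A j : A \in G -> j <= height G A ->
  exists s, [/\ size s = j, all [in G] s &
    sorted (fun A B : {set 'I_n} => A \proper B) (rcons s A)].
Proof.
elim: j A => [|j IH] A AG jA; first by exists [::].
have /height_pred[B [BG BA e]] : 0 < height G A by lia.
have [|s [sj sG ss]] := IH B BG; first by lia.
exists (rcons s B); split; rewrite ?size_rcons ?sj // ?all_rcons ?BG //.
case: s ss {sj sG} => [|C s] /=; first by rewrite BA.
by rewrite !rcons_path last_rcons => ->.
Qed.

Lemma chain_freeE G : 0 < k -> chain_free k G = low_heights G.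
Proof.
move=> k0; apply/idP/idP.
  apply: contraR; rewrite negb_forall => /existsP[A]; rewrite negb_imply => /andP[AG].
  rewrite -leqNgt => hA.
  have [|s [sj sG ss]] := @height_chain G A k.-1 AG; first by lia.
  have sk : size (rcons s A) == k by rewrite size_rcons sj prednK.
  apply/existsP; exists (Tuple sk); rewrite /is_chain /= ss /=.
  by rewrite all_rcons AG.
move=> /forallP lowG; apply/existsP => -[[s s_k]]; rewrite /is_chain /=.
case: s s_k => [|A s] /= /eqP sk; first by rewrite -sk in k0.
move=> /andP[ps /andP[AG sG]].
have lG : last A s \in G.
  by have := mem_last A s; rewrite inE; case/predU1P => [-> //|ls]; exact: (allP sG _ ls).
have := lowG (last A s); rewrite lG /= -sk ltnS => low.
have := leq_ltn_trans (leq_trans (leq_addl _ _) (path_height AG sG ps)) low.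
by rewrite ltnn.
Qed.

End Valid.

(** * Maximal chains of the cube *)

Section MaximalChains.
Variable n : nat.
Implicit Types (A B : {set 'I_n}) (i j : 'I_n.+1).

(** A maximal chain is stored as the function sending each size to its member of that size. *)
Definition max_chain := {ffun 'I_n.+1 -> {set 'I_n}}.
Implicit Types f g : max_chain.

Definition max_chains : {set max_chain} :=
  [set f : max_chain | [forall i : 'I_n.+1, #|f i| == i] &&
     [forall i : 'I_n.+1, forall j : 'I_n.+1, (i <= j) ==> (f i \subset f j)]].

Definition meets f A := f (inord #|A|) == A.

Definition through A : {set max_chain} := [set f in max_chains | meets f A].

Lemma card_lt A : #|A| < n.+1.
Proof. by rewrite ltnS -[X in _ <= X]card_ord max_card. Qed.

Lemma max_chainsP f : reflect ((forall i, #|f i| = i) /\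
  (forall i j, i <= j -> f i \subset f j)) (f \in max_chains).
Proof.
rewrite inE; apply: (iffP andP) => -[H1 H2]; split.
- by move=> i; apply/eqP; apply: (forallP H1).
- by move=> i j ij; apply: (implyP (forallP (forallP H2 i) j)).
- by apply/forallP => i; apply/eqP.
- by apply/forallP => i; apply/forallP => j; apply/implyP; apply: H2.
Qed.

Lemma card_chain f i : f \in max_chains -> #|f i| = i.
Proof. by case/max_chainsP. Qed.

Lemma sub_chain f i j : f \in max_chains -> i <= j -> f i \subset f j.
Proof. by case/max_chainsP => _; apply. Qed.

Lemma meets_chain f i : f \in max_chains -> meets f (f i).
Proof. by move=> fM; rewrite /meets card_chain // inord_val. Qed.

Lemma meets_sub f A B : f \in max_chains -> meets f A -> meets f B ->
  #|A| <= #|B| -> A \subset B.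
Proof.
move=> fM /eqP {2}<- /eqP {2}<- AB; apply: sub_chain => //.
by rewrite !inordK ?card_lt.
Qed.

Lemma meets_proper f A B : f \in max_chains -> meets f A -> meets f B ->
  (A \proper B) = (#|A| < #|B|).
Proof.
move=> fM fA fB; apply/idP/idP => [/proper_card //|AB].
rewrite properEcard AB andbT; exact: (meets_sub fM fA fB (ltnW AB)).
Qed.

Lemma meets_eq f A B : meets f A -> meets f B -> #|A| = #|B| -> A = B.
Proof. by move=> /eqP fA /eqP fB e; rewrite -fA e. Qed.

Lemma max_chains_gt0 : 0 < #|max_chains|.
Proof.
apply/card_gt0P; exists [ffun i : 'I_n.+1 => [set x : 'I_n | x < i]].
apply/max_chainsP; split=> [i|i j ij]; rewrite !ffunE.
  have wi : injective (widen_ord (leq_ord i)) by move=> x y /(congr1 val) /= /val_inj.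
  rewrite -[RHS](card_ord i) -(card_imset _ wi).
  apply: eq_card => x; rewrite inE; apply/idP/imsetP => [xi|[y _ ->] //=].
  by exists (Ordinal xi) => //; apply: val_inj.
by apply/subsetP => x; rewrite !inE => /leq_trans; apply.
Qed.

Lemma in_through A f : (f \in through A) = (f \in max_chains) && meets f A.
Proof. by rewrite inE. Qed.

Lemma through_max_chains A f : f \in through A -> f \in max_chains.
Proof. by rewrite in_through => /andP[]. Qed.

Section Action.
Variable p : {perm 'I_n}.
Definition perm_chain f : max_chain := [ffun i => p @: f i].

Lemma perm_chain_in f : f \in max_chains -> perm_chain f \in max_chains.
Proof.
move=> fM; apply/max_chainsP; split=> [i|i j ij]; rewrite !ffunE.
  by rewrite card_imset ?card_chain //; apply: perm_inj.
by apply: imsetS; apply: sub_chain.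
Qed.

Lemma perm_chain_meets f A : meets (perm_chain f) (p @: A) = meets f A.
Proof.
rewrite /meets ffunE card_imset; last exact: perm_inj.
by apply/eqP/eqP => [/(imset_inj (@perm_inj _ p))|->].
Qed.

Lemma perm_chain_inj : injective perm_chain.
Proof.
move=> f g /ffunP fg; apply/ffunP => i; have := fg i; rewrite !ffunE.
exact: (imset_inj (@perm_inj _ p)).
Qed.

End Action.

Lemma leq_card_through2 (p : {perm 'I_n}) A B : #|through A :&: through B| <=
  #|through (p @: A) :&: through (p @: B)|.
Proof.
rewrite -(card_imset _ (@perm_chain_inj p)); apply: subset_leq_card.
apply/subsetP => _ /imsetP[f + ->]; rewrite !in_setI !in_through => /andP[/andP[fM fA] /andP[_ fB]].
by rewrite perm_chain_in // !perm_chain_meets fA fB.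
Qed.

Lemma tpermK_imset (x y : 'I_n) A : tperm x y @: (tperm x y @: A) = A.
Proof.
by rewrite -imset_comp -[RHS]imset_id; apply: eq_imset => z /=; rewrite tpermK.
Qed.

Lemma card_through2 (x y : 'I_n) A B : #|through A :&: through B| =
  #|through (tperm x y @: A) :&: through (tperm x y @: B)|.
Proof.
apply/eqP; rewrite eqn_leq leq_card_through2 /=.
by have := leq_card_through2 (tperm x y) (tperm x y @: A) (tperm x y @: B); rewrite !tpermK_imset.
Qed.

Lemma tperm_swap (x y : 'I_n) A : x \in A -> y \notin A ->
  tperm x y @: A = y |: (A :\ x).
Proof.
move=> xA yA; apply/setP => z; rewrite -{1}(tpermK x y z) mem_imset; last exact: perm_inj.
rewrite !inE; case: tpermP => [->|->|/eqP zx /eqP zy].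
- by rewrite (negbTE yA) eqxx orbF; apply/esym/eqP => e; rewrite -e xA in yA.
- by rewrite xA eqxx.
- by rewrite (negbTE zy) zx.
Qed.

(** Exchanging an element of A \ B with one of B \ A by a transposition preserves the count and
    brings [A] one step closer to [B]. *)
Lemma card_through_eq A B : #|A| = #|B| -> #|through A| = #|through B|.
Proof.
move: {2}#|A :\: B| (erefl #|A :\: B|) => m.
elim: m A => [|m IH] A eAB cAB.
  suff -> : A = B by [].
  by apply/eqP; rewrite eqEcard cAB leqnn andbT -setD_eq0 -cards_eq0 eAB.
have /card_gt0P[x xAB] : 0 < #|A :\: B| by rewrite eAB.
have /card_gt0P[y yBA] : 0 < #|B :\: A|.
  have := cardsID B A; have := cardsID A B; rewrite setIC; lia.
move: (xAB) (yBA); rewrite !inE => /andP[xB xA] /andP[yA yB].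
have := card_through2 x y A A; rewrite !setIid => ->.
apply: IH; last by rewrite card_imset //; apply: perm_inj.
rewrite tperm_swap //.
have -> : (y |: A :\ x) :\: B = (A :\: B) :\ x.
  apply/setP => z; rewrite !inE; case: eqP => [->|] /=; rewrite ?yB //= ?andbF //.
  by case: (z \in B); rewrite ?andbF.
by have := cardsD1 x (A :\: B); rewrite xAB; lia.
Qed.

(** The LYM identity: every maximal chain has exactly one member of each size, and all sets of that
    size are equally likely. *)
Lemma card_through A : #|through A| * 'C(n, #|A|) = #|max_chains|.
Proof.
have an : #|A| <= n by rewrite -ltnS card_lt.
have -> : #|max_chains| = \sum_(B : {set 'I_n} | #|B| == #|A|) #|through B|.
  rewrite -sum1_card (partition_big (fun f : max_chain => f (inord #|A|))
    (fun B => #|B| == #|A|)) /=.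
    apply: eq_bigr => B /eqP BA; rewrite -[RHS]sum1_card; apply: eq_bigl => f.
    by rewrite in_through /meets BA.
  by move=> f fM; rewrite card_chain // inordK ?card_lt.
rewrite (eq_bigr (fun=> #|through A|)); last by move=> B /eqP/card_through_eq.
rewrite sum_nat_const mulnC; congr (_ * _).
rewrite -[X in 'C(X, _)](card_ord n) -card_draws.
by apply: eq_card => B; rewrite !inE.
Qed.

Lemma through_gt0 A : 0 < #|through A|.
Proof.
by have := max_chains_gt0; rewrite -(card_through A); case: #|_|.
Qed.

(* The [n - #|B| + 1] sets obtained from [B] by exchanging a fixed element of
   [B :\: A] are equally likely to lie on a random chain through [A]. *)
Lemma card_through2_le A B : A \proper B ->
  #|through A :&: through B| * (n - #|B|).+1 <= #|through A|.
Proof.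
move=> /properP[AB [x xB xA]].
pose Y := x |: ~: B.
have cY : #|Y| = (n - #|B|).+1.
  by rewrite cardsU1 inE xB /= cardsCs setCK card_ord.
rewrite -cY mulnC -sum_nat_const.
pose By y := tperm x y @: B.
have eA y : y \in Y -> tperm x y @: A = A.
  rewrite !inE => /orP yY; apply/setP => z.
  rewrite -{1}(tpermK x y z) mem_imset; last exact: perm_inj.
  case: tpermP => // [->|->]; last first.
    case: yY => [/eqP -> //|yB]; rewrite (negbTE xA).
    by apply/esym/negbTE; apply: contra yB => /(subsetP AB).
  case: yY => [/eqP -> //|yB]; rewrite (negbTE xA).
  by apply/negbTE; apply: contra yB => /(subsetP AB).
rewrite (eq_bigr (fun y => #|through A :&: through (By y)|)); last first.
  by move=> y yY; rewrite (card_through2 x y) eA.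
have dis y y' : y \in Y -> y' \in Y -> By y = By y' -> y = y'.
  have mem_y u : u \in Y -> (x \in By u) = (u == x).
    rewrite /By !inE => /orP[/eqP ->|uB].
      by rewrite tperm1 (eq_imset _ (@perm1 _)) imset_id xB eqxx.
    rewrite tperm_swap // !inE eqxx /= orbF eq_sym.
    by [].
  move=> yY y'Y e.
  case: (eqVneq y x) => [yx|yx].
    by have := mem_y _ y'Y; rewrite -e mem_y // yx eqxx => /esym/eqP ->.
  have y'x : y' != x by rewrite -mem_y // -e mem_y.
  move: yY y'Y; rewrite !inE (negbTE yx) (negbTE y'x) /= => yB y'B.
  have : y \in By y by rewrite /By tperm_swap // !inE eqxx.
  rewrite e /By tperm_swap // !inE (negbTE yB) andbF orbF => /eqP //.
rewrite -sum1_card.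
under eq_bigr do rewrite -sum1_card.
rewrite (exchange_big_dep (mem (through A))) /=; last by move=> y f _; rewrite in_setI => /andP[].
apply: leq_sum => f fA; rewrite sum1_card.
apply/card_le1_eqP => y y' /andP[yY]; rewrite !in_setI !in_through => /and3P[_ _ m1].
move=> /andP[y'Y]; rewrite !in_setI !in_through => /and3P[_ _ m2].
apply: dis => //.
by apply: (meets_eq m2 m1); rewrite !card_imset //; apply: perm_inj.
Qed.

Section Splice.
Variable b : nat.

Definition splice f g : max_chain := [ffun i : 'I_n.+1 => if i <= b then f i else g i].

Lemma splice_in B f g : #|B| = b -> f \in through B -> g \in through B ->
  splice f g \in through B.
Proof.
move=> Bb; rewrite !in_through => /andP[fM fB] /andP[gM gB].
have eb : splice f g (inord b) = B.
  by rewrite ffunE inordK ?leqnn -?Bb ?card_lt //; move/eqP: fB.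
apply/andP; split; last by rewrite /meets Bb eb.
apply/max_chainsP; split=> [i|i j ij]; rewrite !ffunE.
  by case: ifP; rewrite card_chain.
case: leqP => ib; case: leqP => jb; try exact: sub_chain; last by lia.
apply: (subset_trans (B := B)).
  by rewrite -(eqP fB) sub_chain // Bb inordK // -Bb card_lt.
by rewrite -(eqP gB) sub_chain // Bb inordK ?(ltnW jb) // -Bb card_lt.
Qed.

Lemma spliceK f g : splice (splice f g) (splice g f) = f.
Proof. by apply/ffunP => i; rewrite !ffunE; case: ifP => // ->. Qed.

End Splice.

Section Markov.
Local Open Scope ring_scope.
Variables (R : comNzRingType) (B : {set 'I_n}) (lo hi : max_chain -> R).
Hypothesis lo_below : forall f g, f \in through B -> g \in through B ->
  (forall i, (i <= #|B|)%N -> f i = g i) -> lo f = lo g.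
Hypothesis hi_above : forall f g, f \in through B -> g \in through B ->
  (forall i, (#|B| <= i)%N -> f i = g i) -> hi f = hi g.

(* Given that it passes through [B], the two halves of a random maximal chain
   are independent: exchange the upper halves of two chains. *)
Lemma through_indep :
  (\sum_(f in through B) lo f * hi f) * #|through B|%:R =
  (\sum_(f in through B) lo f) * (\sum_(f in through B) hi f).
Proof.
pose sw (fg : max_chain * max_chain) := (splice #|B| fg.1 fg.2, splice #|B| fg.2 fg.1).
have swK : involutive sw by move=> [f g]; rewrite /sw /= !spliceK.
have sw_in fg : (sw fg \in setX (through B) (through B)) = (fg \in setX (through B) (through B)).
  have imp u : u \in setX (through B) (through B) -> sw u \in setX (through B) (through B).
    by case: u => f g; rewrite /sw !in_setX /= => /andP[u1 u2]; rewrite !splice_in.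
  by apply/idP/idP => [/imp|/imp //]; rewrite swK.
have -> : (\sum_(f in through B) lo f) * (\sum_(f in through B) hi f) =
   \sum_(fg in setX (through B) (through B)) lo fg.1 * hi fg.2.
  rewrite mulr_suml; under eq_bigr do rewrite mulr_sumr.
  by rewrite pair_big /=; apply: eq_bigl => -[f g]; rewrite in_setX.
have -> : (\sum_(f in through B) lo f * hi f) * #|through B|%:R =
   \sum_(fg in setX (through B) (through B)) lo fg.1 * hi fg.1.
  rewrite mulr_suml (eq_bigl (fun fg => (fg.1 \in through B) && (fg.2 \in through B))); last first.
    by move=> -[f g]; rewrite in_setX.
  rewrite -(pair_big (mem (through B)) (mem (through B)) (fun f g => lo f * hi f)) /=.
  under [RHS]eq_bigr do rewrite sumr_const -[_ *+ _]mulr_natr.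
  by [].
rewrite (reindex_inj (inv_inj swK)) /=; apply: eq_big => [u|[f g]]; first exact: sw_in.
rewrite sw_in in_setX => /andP[/= u1 u2]; congr (_ * _).
  apply: lo_below; rewrite ?splice_in // => i iB; by rewrite ffunE iB.
apply: hi_above; rewrite ?splice_in // => i; rewrite leq_eqVlt => /orP[/eqP iB|iB].
  rewrite ffunE -iB leqnn; move: u1 u2; rewrite !in_through => /andP[_ /eqP m1] /andP[_ /eqP m2].
  have -> : i = inord #|B| by apply: val_inj; rewrite /= inordK ?card_lt // iB.
  by rewrite m1 m2.
by rewrite ffunE leqNgt iB.
Qed.

End Markov.

Definition dual_chain f : max_chain := [ffun i => ~: f (rev_ord i)].

Lemma dual_chainK : involutive dual_chain.
Proof. by move=> f; apply/ffunP => i; rewrite !ffunE rev_ordK setCK. Qed.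

Lemma dual_chain_in f : (dual_chain f \in max_chains) = (f \in max_chains).
Proof.
have imp g : g \in max_chains -> dual_chain g \in max_chains.
  move=> gM; apply/max_chainsP; split=> [i|i j ij]; rewrite !ffunE.
    rewrite cardsCs setCK card_ord card_chain //=; have := ltn_ord i; lia.
  by rewrite setCS sub_chain //=; lia.
by apply/idP/idP => [/imp|/imp //]; rewrite dual_chainK.
Qed.

Lemma dual_chain_meets f A : meets (dual_chain f) (~: A) = meets f A.
Proof.
rewrite /meets ffunE (inj_eq (@setC_inj _)); congr (f _ == _); apply: val_inj.
have cA : #|~: A| = n - #|A| by rewrite cardsCs setCK card_ord.
have ltA := card_lt A.
by rewrite /= cA !inordK // ?subSS ?subKn // ltnS leq_subr.
Qed.

End MaximalChains.

(** * The trace of a family on a maximal chain *)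

Section Trace.
Variables (n : nat) (F : {set {set 'I_n}}).
Implicit Types (A B C : {set 'I_n}) (f : max_chain n).

Definition trace f := [set A in F | meets f A].

Definition consecutive f A B := [&& A \in trace f, B \in trace f, A \proper B &
  [forall C in trace f, ~~ ((A \proper C) && (C \proper B))]].

Definition next f A := [pick B | consecutive f A B].

Definition position f B := #|[set C in trace f | C \proper B]|.

Lemma in_trace f A : (A \in trace f) = (A \in F) && meets f A.
Proof. by rewrite inE. Qed.

Lemma trace_cmp f A B : f \in max_chains n -> A \in trace f -> B \in trace f ->
  [|| A \proper B, A == B | B \proper A].
Proof.
rewrite !in_trace => fM /andP[_ fA] /andP[_ fB].
rewrite !(meets_proper fM) //; case: (ltngtP #|A| #|B|) => [//|_|e].
  by rewrite !orbT.
by rewrite (meets_eq fA fB e) eqxx.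
Qed.

Lemma consecutive_sub f A B C : f \in max_chains n -> consecutive f A B ->
  C \in trace f -> A \proper C -> B \subset C.
Proof.
move=> fM /and4P[At Bt AB /forallP noC] Ct AC.
have := noC C; rewrite Ct AC /= => nCB.
by have /or3P[/proper_sub //|/eqP -> //|CB] := trace_cmp fM Bt Ct; rewrite CB in nCB.
Qed.

Lemma nextP f A B : f \in max_chains n ->
  (next f A == Some B) = consecutive f A B.
Proof.
move=> fM; rewrite /next; case: pickP => [B' cB'|no]; last by rewrite no.
apply/eqP/idP => [[<-] //|cB]; congr Some; apply/eqP; rewrite eqEsubset.
move: (cB') (cB) => /and4P[_ B't AB' _] /and4P[_ Bt AB _].
by rewrite (consecutive_sub fM cB' Bt AB) (consecutive_sub fM cB B't AB').
Qed.

Lemma next_trace f A B : f \in max_chains n -> next f A = Some B ->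
  B \in trace f /\ A \proper B.
Proof. by move=> fM /eqP; rewrite nextP // => /and4P[]. Qed.

Lemma pred_consecutive f B C : f \in max_chains n -> B \in trace f ->
  C \in trace f -> C \proper B -> exists2 A, consecutive f A B &
  (forall D, D \in trace f -> D \proper B -> D \subset A).
Proof.
move=> fM Bt Ct CB.
have P0 : (C \in trace f) && (C \proper B) by rewrite Ct.
case: (@arg_maxnP _ C (fun C => (C \in trace f) && (C \proper B)) (fun C => #|C|) P0).
move=> A /andP[At AB] maxA.
have subA : (forall D, D \in trace f -> D \proper B -> D \subset A).
  move=> D Dt DB; have := maxA D; rewrite Dt DB => /(_ isT) le.
  move: Dt At; rewrite !in_trace => /andP[_ mD] /andP[_ mA].
  exact: (meets_sub fM mD mA le).
exists A => //; apply/and4P; split => //; apply/forallP => D; apply/implyP => Dt.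
by apply/negP => /andP[AD DB]; move: AD; rewrite properE subA ?andbF.
Qed.

(** Telescoping along the trace. It is applied with heights as the potential [p]. *)
Lemma trace_potential f (p g : {set 'I_n} -> nat) B : f \in max_chains n ->
  B \in trace f ->
  (forall A A', consecutive f A A' -> A' \subset B -> p A + g A <= p A') ->
  \sum_(C in trace f | C \proper B) g C <= p B.
Proof.
move=> fM; move: {2}#|B| (leqnn #|B|) => m.
elim: m B => [|m IH] B Bm Bt step.
  rewrite big1 // => C /andP[_ /proper_card]; lia.
case: (pickP [pred C in trace f | C \proper B]) => [C /andP[Ct CB]|no]; last first.
  by rewrite big_pred0.
have [A cA maxA] := pred_consecutive fM Bt Ct CB.
have /and4P[At _ AB _] := cA.
apply: leq_trans (step A B cA (subxx _)).
rewrite (bigD1 A) ?At //= addnC leq_add2r.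
have le : \sum_(C in trace f | C \proper A) g C <= p A.
  apply: IH => //; first by have := proper_card AB; lia.
  move=> D D' cD D'A; apply: step => //; exact: subset_trans D'A (proper_sub AB).
apply: leq_trans le; rewrite leq_eqVlt; apply/orP; left; apply/eqP.
apply: eq_bigl => D; rewrite -andbA; case: (boolP (D \in trace f)) => //= Dt.
rewrite [in RHS]properEneq andbC; case: (D != A) => //=.
apply/idP/idP => [/(maxA _ Dt) //|DA]; exact: sub_proper_trans DA AB.
Qed.

(** Here [top] is the potential of a virtual set above the whole chain. *)
Lemma trace_potential_top f (p g : {set 'I_n} -> nat) top : f \in max_chains n ->
  (forall A, A \in trace f ->
    p A + g A <= if next f A is Some B then p B else top) ->
  \sum_(C in trace f) g C <= top.
Proof.
move=> fM step.
case: (pickP [in trace f]) => [C0 C0t|no]; last by rewrite big_pred0.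
case: (@arg_maxnP _ C0 [in trace f] (fun C => #|C|) C0t) => B Bt maxB.
have nB : next f B = None.
  case e : (next f B) => [C|//]; have [Ct BC] := next_trace fM e.
  by have := maxB C Ct; rewrite /geq /= leqNgt proper_card.
apply: leq_trans (_ : p B + g B <= _); last by have := step B Bt; rewrite nB.
rewrite (bigD1 B) //= addnC leq_add2r.
apply: leq_trans (_ : \sum_(C in trace f | C \proper B) g C <= _).
  rewrite leq_eqVlt; apply/orP; left; apply/eqP; apply: eq_bigl => D.
  case: (boolP (D \in trace f)) => //= Dt.
  have /or3P[DB|/eqP ->|BD] := trace_cmp fM Dt Bt.
  - by rewrite DB proper_neq.
  - by rewrite eqxx properxx.
  - by have := maxB D Dt; rewrite /geq /= leqNgt proper_card.
apply: trace_potential => // A A' cA _; have /and4P[At _ _ _] := cA.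
by have := step A At; move: cA; rewrite -nextP // => /eqP ->.
Qed.

End Trace.

(** * Complementation of families and chains *)

Section Dual.
Variables (n : nat) (F : {set {set 'I_n}}).
Implicit Types (A B C : {set 'I_n}) (f : max_chain n).

Lemma trace_dual f : trace (dual F) (dual_chain f) = dual (trace F f).
Proof.
apply/setP => A; rewrite -(setCK A) in_dual !in_trace in_dual.
by rewrite dual_chain_meets.
Qed.

Lemma card_dual (G : {set {set 'I_n}}) : #|dual G| = #|G|.
Proof. exact: card_imset (@setC_inj _). Qed.

Lemma dualK (G : {set {set 'I_n}}) : dual (dual G) = G.
Proof. by apply/setP => A; rewrite -(setCK A) !in_dual setCK. Qed.

(** Complementation turns the members above [B] into members below [~: B]; the successor counts [B]
    itself. *)
Lemma card_trace_split f B : f \in max_chains n -> B \in trace F f ->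
  #|trace F f| = (position F f B + position (dual F) (dual_chain f) (~: B)).+1.
Proof.
move=> fM Bt.
have -> : position (dual F) (dual_chain f) (~: B) =
    #|[set C in trace F f | B \proper C]|.
  rewrite -card_dual /position trace_dual; apply: eq_card => C.
  rewrite -(setCK C) in_dual [~: ~: C \in _]inE in_dual properC.
  by rewrite [in RHS]inE.
rewrite (cardsD1 B) Bt add1n; congr _.+1.
rewrite -(cardsID [set C : {set 'I_n} | C \proper B] (trace F f :\ B)); congr addn.
  apply: eq_card => C; rewrite in_setI in_setD1 !in_set.
  by case: (eqVneq C B) => [->|_]; rewrite ?properxx ?andbF.
apply: eq_card => C; rewrite in_setD in_setD1 [C \in [set _ | _]]inE [RHS]inE.
case: (boolP (C \in trace F f)) => Ct; rewrite ?andbF //= andbT.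
have /or3P[CB|/eqP ->|BC] := trace_cmp fM Ct Bt.
- by rewrite CB /=; apply/esym/negbTE; rewrite properE (proper_sub CB) andbF.
- by rewrite eqxx properxx.
- by rewrite BC eq_sym (proper_neq BC) andbT properE (proper_sub BC) andbF.
Qed.

End Dual.

(** * Conflicts along a maximal chain *)

Lemma height_mono (T : finType) (G : {set {set T}}) (A B : {set T}) :
  A \subset B -> height G A <= height G B.
Proof.
move=> AB; case: (posnP (height G A)) => [-> //|/height_pred[C [CG CA ->]]].
by apply: height_lt => //; apply: proper_sub_trans CA AB.
Qed.

Lemma conflict_step a b c d : a <= c -> b <= d -> (a < c) || (b < d) ->
  a + b + (~~ ((c <= a) || (d <= b))).+1 <= c + d.
Proof.
move=> ac bd; case: (leqP c a) => h1; case: (leqP d b) => h2 //= _; lia.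
Qed.

Lemma conflict_step_top k a b : a < k -> b < k -> (a.+1 < k \/ b.+1 < k) ->
  a + b + (~~ ((k <= a.+1) || (k <= b.+1))).+1 <= k.-1.*2.
Proof.
move=> ak bk h; case: (leqP k a.+1) => h1; case: (leqP k b.+1) => h2 /=; lia.
Qed.

Section Conflict.
Variables (n k : nat) (F : {set {set 'I_n}}).
Implicit Types (A B C : {set 'I_n}) (R : {set {set 'I_n}}) (f : max_chain n).

Definition valid_red R := [&& R \subset F, low_heights k R & low_heights k (F :\: R)].

(* Given the colours of the sets below [A] and the two heights of [B], a
   conflict determines the colour of [A]. *)
Definition conflict R A B :=
  (height R B <= height R A) || (height (F :\: R) B <= height (F :\: R) A).

(** A conflict with a virtual set above all others, both of whose heights equal k - 1, the largest
    possible value. *)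
Definition conflict_top R A :=
  (k <= (height R A).+1) || (k <= (height (F :\: R) A).+1).

Definition conflict_next R f A :=
  if next F f A is Some B then conflict R A B else conflict_top R A.

Lemma low_heights_lt G A : 0 < k -> low_heights k G -> height G A < k.
Proof.
move=> k0 /forallP low; case: (posnP (height G A)) => [-> //|/height_pred[B [BG BA ->]]].
by have := low B; rewrite BG.
Qed.

(* The sum of the red and the blue height lies between 0 and 2k - 2. It grows by at
   least 1 along the trace, and by at least 2 where there is no conflict. *)
Lemma sum_conflict R f : 2 <= k -> valid_red R -> f \in max_chains n ->
  \sum_(A in trace F f) (~~ conflict_next R f A).+1 <= k.-1.*2.
Proof.
move=> k2 /and3P[RF lowR lowB] fM.
have k0 : 0 < k by apply: leq_trans k2.
apply: (@trace_potential_top _ _ _ (fun A => height R A + height (F :\: R) A)) => // A At.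
have AF : A \in F by move: At; rewrite in_trace => /andP[].
have lR := low_heights_lt A k0 lowR; have lB := low_heights_lt A k0 lowB.
rewrite /conflict_next; case e : (next F f A) => [B|].
  have [Bt AB] := next_trace fM e.
  have mR := height_mono R (proper_sub AB); have mB := height_mono (F :\: R) (proper_sub AB).
  have : (height R A < height R B) || (height (F :\: R) A < height (F :\: R) B).
    case: (boolP (A \in R)) => AR; first by rewrite height_lt.
    by rewrite (@height_lt _ (F :\: R) B A) ?orbT // in_setD AR.
  exact: conflict_step.
have : (height R A).+1 < k \/ (height (F :\: R) A).+1 < k.
  case: (boolP (A \in R)) => AR; [left|right].
    by move/forallP: lowR => /(_ A); rewrite AR.
  by move/forallP: lowB => /(_ A); rewrite in_setD AR AF.
exact: conflict_step_top.
Qed.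

(** Without conflicts up to [B], every step of the trace raises both heights, not only that of the
    colour used. *)
Lemma position_le_height R f B : f \in max_chains n -> B \in trace F f -> R \subset F ->
  (forall A A', consecutive F f A A' -> A' \subset B -> ~~ conflict R A A') ->
  (position F f B <= height R B) && (position F f B <= height (F :\: R) B).
Proof.
move=> fM Bt RF nc.
have pE : position F f B = \sum_(C in trace F f | C \proper B) 1.
  by rewrite sum1_card /position; apply: eq_card => C; rewrite [LHS]inE.
rewrite pE; apply/andP; split; apply: trace_potential => // A A' cA A'B;
  have := nc A A' cA A'B; rewrite negb_or -!ltnNge => /andP[h1 h2]; by rewrite addn1.
Qed.

End Conflict.

(** * Binomial coefficients around the middle *)

Section Binomial.

Lemma bin_mono n i j : i <= j -> j.*2 <= n.+1 -> 'C(n, i) <= 'C(n, j).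
Proof.
elim: j => [|j IH]; first by rewrite leqn0 => /eqP ->.
rewrite leq_eqVlt => /predU1P[-> //|ij] jn.
apply: leq_trans (IH _ _) _ => //; first by lia.
rewrite -(leq_pmul2l (ltn0Sn j)) mul_bin_left leq_mul2r; apply/orP; right; lia.
Qed.

(** The lowest of the k - 1 middle levels. Its binomial coefficient is a threshold: levels in the
    window are at least as large, the others at most as large. *)
Definition low_level n k := (n + 2 - k) %/ 2.

Variables n k : nat.
Hypotheses (k2 : 2 <= k) (kn : k <= n).
Let lo := low_level n k.

Lemma bin_le_low i : i <= n -> ~~ (lo <= i < ((n + k - 2) %/ 2).+1) -> 'C(n, i) <= 'C(n, lo).
Proof.
move=> i_n; rewrite /lo /low_level; case: leqP => /= h1 h2; last by apply: bin_mono; lia.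
by rewrite -bin_sub //; apply: bin_mono; lia.
Qed.

Lemma bin_ge_low i : lo <= i < ((n + k - 2) %/ 2).+1 -> 'C(n, lo) <= 'C(n, i).
Proof.
rewrite /lo /low_level => h; case: (leqP i.*2 n) => h2; first by apply: bin_mono; lia.
by rewrite -[X in _ <= X]bin_sub; [apply: bin_mono|]; lia.
Qed.

Lemma window_size : ((n + k - 2) %/ 2).+1 - lo = k.-1.
Proof. rewrite /lo /low_level; lia. Qed.

Lemma window_le_n : ((n + k - 2) %/ 2).+1 <= n.+1.
Proof. lia. Qed.

Lemma sum_window (T : nmodType) (g : nat -> T) :
  (\sum_(i < n.+1 | (low_level n k <= i < ((n + k - 2) %/ 2).+1)%N) g i =
   \sum_(low_level n k <= i < ((n + k - 2) %/ 2).+1) g i)%R.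
Proof.
rewrite -(big_mkord (fun i => low_level n k <= i < ((n + k - 2) %/ 2).+1) g).
rewrite (big_nat_widen _ _ _ _ _ window_le_n) [RHS](big_nat_widenl _ 0) //.
by apply: eq_bigl => i; rewrite /= andbC.
Qed.

Hypothesis kkn : 4 * k ^ 2 <= n.

(** At most [k] steps lead from [lo] to the middle, each multiplying by at most n / (n - 2k). As in
    Bernoulli's inequality, the product is at most n / (n - 2k^2), hence at most 2. *)
Lemma bin_le_twice_low i : 'C(n, i) <= 2 * 'C(n, lo).
Proof.
wlog i2 : i / i.*2 <= n => [hw|].
  case: (leqP i.*2 n) => [/hw //|h]; case: (leqP i n) => [i_n|h2]; last by rewrite bin_small.
  by rewrite -bin_sub //; apply: hw; lia.
case: (leqP i lo) => [ilo|loi].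
  rewrite mul2n -addnn; apply: leq_trans (leq_addr _ _); apply: bin_mono => //.
  rewrite /lo /low_level; lia.
have step j : lo <= j -> j.*2 <= n -> (n - 2 * k) * 'C(n, j.+1) <= n * 'C(n, j).
  rewrite /lo /low_level => h1 h2.
  rewrite -(leq_pmul2l (ltn0Sn j)) mulnCA mul_bin_left [X in _ <= X]mulnCA.
  rewrite !mulnA leq_mul2r; apply/orP; right; nia.
have main d : (lo + d).*2 <= n.+2 -> (n - 2 * k * d) * 'C(n, lo + d) <= n * 'C(n, lo).
  elim: d => [|d IH] h; first by rewrite muln0 subn0 addn0.
  have n0 : 0 < n by lia.
  have {}IH := IH ltac:(lia).
  have {}step := step (lo + d) ltac:(lia) ltac:(lia).
  rewrite -(leq_pmul2l n0) addnS.
  apply: (@leq_trans (((n - 2 * k * d) * (n - 2 * k)) * 'C(n, (lo + d).+1))).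
    rewrite mulnA leq_mul2r; apply/orP; right; nia.
  rewrite -mulnA; apply: leq_trans (leq_mul (leqnn _) step) _.
  by rewrite mulnCA leq_mul2l IH orbT.
have := main (i - lo) ltac:(lia); rewrite subnKC ?(ltnW loi) // => h.
have d_k : i - lo <= k by rewrite /lo /low_level; lia.
have n0 : 0 < n by lia.
rewrite -(leq_pmul2l n0).
have : n <= 2 * (n - 2 * k * (i - lo)) by nia.
move: h; move: (n - 2 * k * (i - lo)) 'C(n, i) 'C(n, lo) => a b c; nia.
Qed.

End Binomial.

(** * Weighing a trace against the middle levels *)

Section LevelWeights.
Local Open Scope ring_scope.
Variables (R : realType) (n k : nat) (F : {set {set 'I_n}}).
Hypotheses (k2 : (2 <= k)%N) (kn : (k <= n)%N).
Implicit Types (A : {set 'I_n}) (f : max_chain n).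

Definition low_bin : R := 'C(n, low_level n k)%:R.

Lemma low_bin_gt0 : 0 < low_bin.
Proof. rewrite /low_bin ltr0n bin_gt0 /low_level; lia. Qed.

(** [low_bin] acts as a Lagrange multiplier for the total weight. After subtracting it, levels in
    the window count nonnegatively and the others nonpositively, so weight 1 on exactly the window
    is optimal. *)
Lemma trace_weight f (w : {set 'I_n} -> R) : f \in max_chains n ->
  (forall A, A \in trace F f -> 0 <= w A <= 1) ->
  \sum_(A in trace F f) 'C(n, #|A|)%:R * w A <=
  (middle_levels_size n k)%:R + low_bin * (\sum_(A in trace F f) w A - (k.-1)%:R).
Proof.
move=> fM w01; set mu := low_bin.
pose win (i : nat) := (low_level n k <= i < ((n + k - 2) %/ 2).+1)%N.
have -> : (middle_levels_size n k)%:R =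
    \sum_(i < n.+1 | win i) ('C(n, i)%:R - mu) + mu * (k.-1)%:R.
  rewrite (sum_window k2 kn (fun i => 'C(n, i)%:R - mu)) sumrB sumr_const_nat.
  rewrite window_size // -[mu *+ _]mulr_natr.
  by rewrite /middle_levels_size natr_sum subrK.
rewrite mulrBr addrACA subrr addr0 mulr_sumr -lerBlDr -sumrB.
have -> : \sum_(i < n.+1 | win i) ('C(n, i)%:R - mu) =
  \sum_(A in f @: [set i : 'I_n.+1 | win i]) ('C(n, #|A|)%:R - mu).
  rewrite big_imset /=; last first.
    by move=> i j _ _ /(congr1 (fun A : {set _} => #|A|)); rewrite !card_chain // => /val_inj.
  apply: eq_big => i; first by rewrite inE.
  by move=> _; rewrite card_chain.
rewrite [X in X <= _](bigID (fun A => win #|A|)) /=.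
rewrite -[X in _ <= X]addr0; apply: lerD; last first.
  apply: sumr_le0 => A /andP[At nw]; rewrite -mulrBl; have /andP[w0 _] := w01 A At.
  rewrite mulr_le0_ge0 // subr_le0 /mu /low_bin ler_nat bin_le_low //.
  by rewrite -ltnS card_lt.
have -> : \sum_(A in f @: [set i : 'I_n.+1 | win i]) ('C(n, #|A|)%:R - mu) =
  \sum_(A | meets f A && win #|A|) ('C(n, #|A|)%:R - mu).
  apply: eq_bigl => A; apply/imsetP/andP => [[i + ->]|[mA wA]].
    by rewrite inE => wi; rewrite meets_chain // card_chain.
  by exists (inord #|A|); [rewrite inE inordK ?card_lt|rewrite (eqP mA)].
rewrite [X in _ <= X](bigID (fun A => A \in F)) /= -[X in X <= _]addr0; apply: lerD.
  rewrite [X in X <= _](eq_bigl (fun A => meets f A && win #|A| && (A \in F))); last first.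
    by move=> A; rewrite in_trace -andbA andbC.
  apply: ler_sum => A /andP[/andP[mA wA] AF].
  have /andP[w0 w1] : 0 <= w A <= 1 by apply: w01; rewrite in_trace AF.
  rewrite -mulrBl ler_piMr // subr_ge0 /mu /low_bin ler_nat; exact: bin_ge_low.
apply: sumr_ge0 => A /andP[/andP[_ wA] _]; rewrite subr_ge0 /mu /low_bin ler_nat.
exact: bin_ge_low.
Qed.

End LevelWeights.

(** * Entropy bounds from predicting a bit *)

Section Claims.
Local Open Scope ring_scope.
Variables (R : realType) (W : finType) (Om : {set W}) (S : eqType).
Hypothesis Om_gt0 : (0 < #|Om|)%N.
Variables (Y : W -> S) (b D p : W -> bool).
Hypothesis D_Y : {in Om &, forall w w', Y w = Y w' -> D w = D w'}.
Hypothesis p_Y : {in Om &, forall w w', Y w = Y w' -> p w = p w'}.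
Local Notation avg := (@avg R W Om).

(** Code with 0 bits where [D] holds and with 1 bit elsewhere. *)
Lemma cond_entropy_forced : {in Om, forall w, D w -> b w = p w} ->
  cond_entropy R Om Y b <= 1 - avg (fun w => (D w)%:R).
Proof.
move=> Db.
pose q w c : R := if D w then (c == p w)%:R else 2^-1.
apply: (@le_trans _ _ (avg (fun w => - log2 (q w (b w))))).
  apply: gibbs => //.
  - by move=> w c; rewrite /q; case: ifP => _; rewrite ?ler0n // invr_ge0 ler0n.
  - by move=> w; rewrite /q; case: ifP => _; [case: (p w)|]; rewrite /=; lra.
  - by move=> w w' wO w'O e c; rewrite /q (D_Y wO w'O e) (p_Y wO w'O e).
  - move=> w wO; rewrite /q; case: ifP => [/(Db w wO) ->|_]; last by rewrite invr_gt0 ltr0n.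
    by rewrite eqxx ltr01.
rewrite -[X in X - _](avg_cst Om_gt0) -avgB; apply: le_avg => // w wO; rewrite /q.
case: ifP => [/(Db w wO) ->|_]; first by rewrite eqxx log2_1 subrr oppr0.
by rewrite log2V ?ltr0n // opprK log2_2 subr0.
Qed.

(** Here the prediction [p] may be wrong. Given probability 63/64, it costs less than 1/25 bit when
    right and log2 64 = 6 bits when wrong. *)
Lemma cond_entropy_claim :
  cond_entropy R Om Y b <= 1 - 24 / 25 * avg (fun w => (D w)%:R)
    + 6 * avg (fun w => (D w && (b w != p w))%:R).
Proof.
pose q w c : R := if D w then (if c == p w then 63 / 64 else 64^-1) else 2^-1.
apply: (@le_trans _ _ (avg (fun w => - log2 (q w (b w))))).
  apply: gibbs => //.
  - by move=> w c; rewrite /q; case: ifP => _; [case: ifP => _|]; lra.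
  - by move=> w; rewrite /q; case: ifP => _; [case: (p w)|]; rewrite /=; lra.
  - by move=> w w' wO w'O e c; rewrite /q (D_Y wO w'O e) (p_Y wO w'O e).
  - by move=> w _; rewrite /q; case: ifP => _; [case: ifP => _|]; lra.
rewrite -[X in X - _](avg_cst Om_gt0) -!avgZ -avgB -avgD.
apply: le_avg => // w wO; rewrite /q; case: (D w) => /=; last first.
  by rewrite log2V ?ltr0n // opprK log2_2; lra.
have l2 := ln2_ge_half R.
case: eqP => _ /=.
  have h : ln (64 / 63 : R) <= 63^-1 by apply: le_trans (ln_leB1 _) _; lra.
  have -> : log2 (63 / 64 : R) = - log2 (64 / 63) by rewrite -log2V ?invf_div //; lra.
  rewrite opprK /log2 ler_pdivrMr ?ln2_gt0 //; nra.
have -> : (64 : R) = 2 ^+ 6 by rewrite -natrX.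
by rewrite log2V ?exprn_gt0 ?ltr0n // log2X ?ltr0n // log2_2 opprK; lra.
Qed.

End Claims.

(** * Revealing the colours one by one *)

Section FamilyEntropy.
Local Open Scope ring_scope.
Variables (R : realType) (n : nat) (F : {set {set 'I_n}}).
Variable V : {set {set {set 'I_n}}}.
Hypothesis V_gt0 : (0 < #|V|)%N.
Hypothesis V_sub : forall r, r \in V -> r \subset F.
Implicit Types (A B : {set 'I_n}) (r : {set {set 'I_n}}).

Let e := sort (fun A B : {set 'I_n} => #|A| <= #|B|)%N (enum F).

Let e_uniq : uniq e. Proof. by rewrite sort_uniq enum_uniq. Qed.

Let mem_e A : (A \in e) = (A \in F). Proof. by rewrite mem_sort mem_enum. Qed.

(* Sorting by cardinality makes this order a linear extension of inclusion. *)
Definition before A : {set {set 'I_n}} := [set B in take (index A e) e].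

Lemma proper_before A B : A \in F -> B \in F -> B \proper A -> B \in before A.
Proof.
move=> AF BF /proper_card BA.
have Ae : A \in e by rewrite mem_e.
have Be : B \in e by rewrite mem_e.
rewrite inE in_take // ltnNge leq_eqVlt; apply/negP => /predU1P[eAB|lt].
  by rewrite -(nth_index set0 Ae) eAB nth_index ?ltnn // in BA.
have tr : transitive (fun A B : {set 'I_n} => #|A| <= #|B|)%N.
  by move=> ? ? ?; apply: leq_trans.
have tot : total (fun A B : {set 'I_n} => #|A| <= #|B|)%N.
  by move=> ? ?; apply: leq_total.
have := sorted_ltn_index tr (sort_sorted tot (enum F)) A B Ae Be lt.
by rewrite leqNgt BA.
Qed.

Lemma height_before r r' A : A \in F -> r \subset F -> r' \subset F ->
  r :&: before A = r' :&: before A ->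
  height r A = height r' A /\ height (F :\: r) A = height (F :\: r') A.
Proof.
move=> AF rF r'F eq_r.
have h B : B \proper A -> B \in F -> (B \in r) = (B \in r').
  move=> BA BF; have Bb := proper_before AF BF BA.
  by have := congr1 (fun X : {set _} => B \in X) eq_r; rewrite !in_setI Bb !andbT.
split; apply: eq_height => B BA.
  case: (boolP (B \in F)) => BF; first exact: h.
  by rewrite (negbTE (contra (subsetP rF B) BF)) (negbTE (contra (subsetP r'F B) BF)).
by rewrite !in_setD; case: (boolP (B \in F)) => BF; rewrite ?andbF // h.
Qed.

Definition step_entropy A : R :=
  cond_entropy R V (fun r => r :&: before A) (fun r => A \in r).

Definition step_entropy_given (T : eqType) (S : {set {set 'I_n}} -> T) A : R :=
  cond_entropy R V (fun r => (r :&: before A, S r)) (fun r => A \in r).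

Definition step_info (T : eqType) (S : {set {set 'I_n}} -> T) A : R :=
  step_entropy A - step_entropy_given S A.

Lemma step_info_ge0 (T : eqType) (S : {set {set 'I_n}} -> T) A : 0 <= step_info S A.
Proof. by rewrite subr_ge0; apply: cond_entropy_drop. Qed.

(* Summed over [A], the information that [S] carries about the colours is at most
   the entropy of [S]: this is why a single revealed set is cheap although it
   determines the colours of many sets below it. *)
Lemma sum_step_entropy_given (T : eqType) (S : {set {set 'I_n}} -> T) :
  \sum_(A in F) step_entropy_given S A = avg V (fun r => log2 (fiber V S r)%:R).
Proof.
pose obs j (r : {set {set 'I_n}}) := (r :&: [set B in take j e], S r).
(* The entropy that remains once [S] and the colours of the first [j] sets are known. It decreases
   to 0, since all colours together determine [r]. *)
pose L j : R := avg V (fun r => log2 (fiber V (obs j) r)%:R).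
have stepE j : (j < size e)%N ->
    step_entropy_given S (nth set0 e j) = L j - L j.+1.
  move=> je; rewrite /step_entropy_given /cond_entropy avgB /before index_uniq //.
  congr (_ - _); apply: eq_avg => r rV; congr (log2 _%:R).
  apply: eq_fiber => // u v uV vV; rewrite /obs !xpair_eqE (take_nth set0 je).
  set t := take j e; set A := nth set0 e j.
  have -> : (u :&: [set B in rcons t A] == v :&: [set B in rcons t A]) =
      (u :&: [set B in t] == v :&: [set B in t]) && ((A \in u) == (A \in v)).
    apply/eqP/andP => [E|[/eqP E /eqP EA]].
      split; apply/eqP; last first.
        by have := congr1 (fun X : {set _} => A \in X) E; rewrite !inE mem_rcons inE eqxx !andbT.
      apply/setP => B; have := congr1 (fun X : {set _} => B \in X) E.
      rewrite !inE mem_rcons inE; case: (B \in t); rewrite ?andbF //.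
      by rewrite orbT !andbT.
    apply/setP => B; have := congr1 (fun X : {set _} => B \in X) E.
    rewrite !inE mem_rcons inE; case: (eqVneq B A) => [->|] //=.
    by rewrite !andbT EA.
  by rewrite -!andbA; congr andb; rewrite andbC.
have -> : \sum_(A in F) step_entropy_given S A =
    \sum_(0 <= j < size e) (L j - L j.+1).
  rewrite -big_enum (perm_big e) /=; last by rewrite perm_sym perm_sort.
  rewrite (big_nth set0); apply: eq_big_nat => j /andP[_ je]; exact: stepE.
under eq_bigr do rewrite -opprB.
rewrite sumrN telescope_sumr // opprB.
have -> : L (size e) = 0.
  rewrite /L -[RHS](avg_cst V_gt0 0); apply: eq_avg => r rV.
  suff -> : fiber V (obs (size e)) r = 1%N by rewrite log2_1.
  rewrite /fiber -(cards1 r); apply: eq_card => u; rewrite !inE /obs take_size.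
  have eF : [set B in e] = F by apply/setP => B; rewrite inE mem_e.
  rewrite eF xpair_eqE; apply/idP/eqP => [/and3P[uV /eqP + _]|->].
    by rewrite (setIidPl (V_sub uV)) (setIidPl (V_sub rV)).
  by rewrite rV !eqxx.
rewrite subr0; apply: eq_avg => r rV; congr (log2 _%:R).
apply: eq_fiber => // u v uV vV; rewrite /obs take0 xpair_eqE.
have -> : [set B in [::]] = set0 :> {set {set 'I_n}} by apply/setP => B; rewrite !inE.
by rewrite !setI0 eqxx.
Qed.

Lemma sum_step_entropy : \sum_(A in F) step_entropy A = log2 #|V|%:R.
Proof.
rewrite -[RHS](avg_cst V_gt0).
rewrite (eq_bigr (step_entropy_given (fun=> tt))) ?sum_step_entropy_given.
  apply: eq_avg => r rV; congr (log2 _%:R); apply: eq_card => u.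
  by rewrite !inE andbT.
move=> A _; apply: eq_avg => r rV.
by congr (log2 _%:R - log2 _%:R); apply: eq_fiber => // u v _ _; rewrite !xpair_eqE ?andbT.
Qed.

Lemma sum_step_info (T : finType) (S : {set {set 'I_n}} -> T) :
  \sum_(A in F) step_info S A <= log2 #|T|%:R.
Proof.
rewrite /step_info sumrB sum_step_entropy sum_step_entropy_given.
exact: log2_fiber_le.
Qed.

Lemma step_entropy_claim A (D p : {set {set 'I_n}} -> bool) :
  {in V &, forall r r', r :&: before A = r' :&: before A -> D r = D r' /\ p r = p r'} ->
  step_entropy A <= 1 - 24 / 25 * avg V (fun r => (D r)%:R)
    + 6 * avg V (fun r => (D r && ((A \in r) != p r))%:R).
Proof.
move=> inv; apply: cond_entropy_claim => // r r' rV r'V E; by have [] := inv r r' rV r'V E.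
Qed.

Lemma step_entropy_le1 A : step_entropy A <= 1.
Proof.
apply: le_trans (@cond_entropy_forced _ _ _ _ V_gt0 _ _ (fun=> false) (fun=> false) _ _ _) _ => //.
by rewrite gerBl; apply: avg_ge0 => // r _.
Qed.

Variable k : nat.
Hypothesis k2 : (2 <= k)%N.
Hypothesis V_valid : forall r, r \in V -> valid_red k F r.

(** A colour whose height at [A] is already k - 1 is excluded for [A]. *)
Lemma step_entropy_top A : A \in F ->
  step_entropy A <= 1 - avg V (fun r => (conflict_top k F r A)%:R).
Proof.
move=> AF; apply: (@cond_entropy_forced _ _ _ _ V_gt0 _ _ _ (fun r => ~~ (k <= (height r A).+1)%N)).
- move=> r r' rV r'V /(height_before AF (V_sub rV) (V_sub r'V)) [h1 h2].
  by rewrite /conflict_top h1 h2.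
- by move=> r r' rV r'V /(height_before AF (V_sub rV) (V_sub r'V)) [-> _].
move=> r /V_valid/and3P[_ /forallP lR /forallP lB]; rewrite /conflict_top.
have := lR A; have := lB A; rewrite in_setD AF andbT.
case: (A \in r) => /= [_|h _]; first by rewrite ltnNge => ->.
by rewrite [X in _ || X]leqNgt h orbF => ->.
Qed.

(** For valid colourings both heights are below [k], so [inord] does not alter them. The finite type
    yields the 2 log2 k bits. *)
Definition height_pair B r : 'I_k.-1.+1 * 'I_k.-1.+1 :=
  (inord (height r B), inord (height (F :\: r) B)).

Lemma height_pair_val B r : r \in V ->
  val (height_pair B r).1 = height r B /\ val (height_pair B r).2 = height (F :\: r) B.
Proof.
have k0 : (0 < k)%N by apply: leq_trans k2.
move=> /V_valid/and3P[_ lR lB].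
by rewrite /= !inordK ?prednK // low_heights_lt.
Qed.

Definition pair_info B A := step_info (height_pair B) A.

Lemma pair_info_ge0 B A : 0 <= pair_info B A.
Proof. exact: step_info_ge0. Qed.

Lemma sum_pair_info B : \sum_(A in F) pair_info B A <= 2 * log2 (k%:R : R).
Proof.
apply: le_trans (sum_step_info _) _.
have k0 : (0 < k)%N by apply: leq_trans k2.
by rewrite card_prod !card_ord prednK // natrM log2M ?ltr0n // mulr2n mulrDl mul1r.
Qed.

Lemma step_entropy_pair A B : A \in F -> A \proper B ->
  step_entropy A <= 1 - avg V (fun r => (conflict F r A B)%:R) + pair_info B A.
Proof.
move=> AF AB; rewrite /pair_info /step_info -lerBlDr opprB addrC subrK.
apply: (@cond_entropy_forced _ _ _ _ V_gt0 _ _ _ (fun r => ~~ (height r B <= height r A)%N)).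
- move=> r r' rV r'V [/(height_before AF (V_sub rV) (V_sub r'V)) [h1 h2] e1 e2].
  have [a1 a2] := height_pair_val B rV; have [b1 b2] := height_pair_val B r'V.
  rewrite /conflict h1 h2 -a1 -a2 -b1 -b2.
  by rewrite /= e1 e2.
- move=> r r' rV r'V [/(height_before AF (V_sub rV) (V_sub r'V)) [h1 h2] e1 e2].
  have [a1 a2] := height_pair_val B rV; have [b1 b2] := height_pair_val B r'V.
  by rewrite h1 -a1 -b1 /= e1.
move=> r rV; rewrite /conflict.
case: (boolP (A \in r)) => Ar.
  by rewrite leqNgt height_lt.
by case: leqP => //= _; rewrite leqNgt height_lt // in_setD Ar.
Qed.

End FamilyEntropy.

Lemma dual_height_arith (a b c r k : nat) :
  a + b <= c -> r < a -> c.+1 < k -> b + r + 2 < k.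
Proof. lia. Qed.

(** A conflict with the true heights c, d of the upper set is also seen with the typical height [r]
    in their place, unless c or d is smaller than [r]. *)
Lemma conflict_rank_arith (a b c d r : nat) :
  ((c <= a) || (d <= b)) <= ((r <= a) || (r <= b)) + ((c < r) || (d < r)).
Proof.
case: (leqP r a) => h1 /=; first by rewrite (leq_trans (leq_b1 _)).
case: (leqP r b) => h2 /=; first by rewrite (leq_trans (leq_b1 _)).
case: (leqP c a) => h3; first by rewrite (leq_ltn_trans h3 h1).
by case: (leqP d b) => // h4; rewrite (leq_ltn_trans h4 h2) !orbT.
Qed.

(** From (n + 1) C(n, b) = (n + 1 - b) C(n + 1, b) and Pascal's rule. It trades the meeting
    probability 1 / (n - |B| + 1) for O(1/n) times the weight of [B]. *)
Lemma bin_cost_arith n b c : b < n.+1 -> (forall i, 'C(n, i) <= 2 * c) ->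
  n * 'C(n, b) <= 4 * c * (n - b).+1.
Proof.
move=> bn le; apply: (@leq_trans (n.+1 * 'C(n, b))); first by rewrite leq_mul2r leqnSn orbT.
rewrite -[n in 'C(n, b)]/(n.+1.-1) mul_bin_down subSn // mulnC leq_mul2r; apply/orP; right.
have : 'C(n.+1, b) <= 'C(n, b) + 'C(n, b.-1).
  by case: b bn => [|b] _; rewrite ?bin0 ?binS.
have := le b; have := le b.-1; lia.
Qed.

(** * Averages over a random maximal chain *)

Section ChainAverage.
Local Open Scope ring_scope.
Variables (R : realType) (n : nat).
Implicit Types (F U : {set {set 'I_n}}) (A B : {set 'I_n}) (f : max_chain n).

Definition chain_avg (X : max_chain n -> R) : R := avg (max_chains n) X.

Definition chain_prob A : R := ('C(n, #|A|)%:R)^-1.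

(* The expected number of members of [U] on a random maximal chain. *)
Definition density U : R := \sum_(B in U) chain_prob B.

Lemma bin_card_gt0 A : 0 < 'C(n, #|A|)%:R :> R.
Proof. by rewrite ltr0n bin_gt0 -ltnS card_lt. Qed.

Lemma chain_prob_gt0 A : 0 < chain_prob A.
Proof. by rewrite invr_gt0 bin_card_gt0. Qed.

Lemma density_ge0 U : 0 <= density U.
Proof. by apply: sumr_ge0 => B _; rewrite ltW // chain_prob_gt0. Qed.

Lemma chain_probE A : chain_prob A = #|through A|%:R / #|max_chains n|%:R.
Proof.
rewrite -(card_through A) natrM invfM mulrA divff ?mul1r //.
by rewrite pnatr_eq0 -lt0n through_gt0.
Qed.

Lemma sum_trace F f (g : {set 'I_n} -> R) :
  \sum_(A in trace F f) g A = \sum_(A in F) (meets f A)%:R * g A.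
Proof.
rewrite (eq_bigl (fun A => (A \in F) && meets f A)); last by move=> A; rewrite in_trace.
by rewrite big_mkcondr; apply: eq_bigr => A _; case: meets; rewrite ?mul1r ?mul0r.
Qed.

Lemma chain_avg_trace F (g : max_chain n -> {set 'I_n} -> R) :
  chain_avg (fun f => \sum_(A in trace F f) g f A) =
  \sum_(A in F) #|max_chains n|%:R^-1 * \sum_(f in through A) g f A.
Proof.
rewrite /chain_avg /avg (eq_bigr _ (fun f _ => sum_trace F f (g f))).
rewrite exchange_big mulr_sumr; apply: eq_bigr => A _; congr (_ * _).
rewrite [RHS](eq_bigl (fun f => (f \in max_chains n) && meets f A)); last first.
  by move=> f; rewrite in_through.
by rewrite big_mkcondr; apply: eq_bigr => f _; case: meets; rewrite ?mul1r ?mul0r.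
Qed.

Lemma chain_avg_trace_cst F (g : {set 'I_n} -> R) :
  chain_avg (fun f => \sum_(A in trace F f) g A) = \sum_(A in F) chain_prob A * g A.
Proof.
rewrite chain_avg_trace; apply: eq_bigr => A _.
by rewrite sumr_const chain_probE -mulr_natr; ring.
Qed.

Lemma chain_avg_density F U : U \subset F ->
  chain_avg (fun f => #|trace F f :&: U|%:R) = density U.
Proof.
move=> UF; rewrite /density.
transitivity (chain_avg (fun f => \sum_(A in trace F f) (A \in U)%:R)).
  apply: eq_avg => f _; rewrite -sum1_card natr_sum big_mkcond [RHS]big_mkcond /=.
  by apply: eq_bigr => A _; rewrite in_setI; case: (_ \in _); case: (_ \in _).
rewrite chain_avg_trace_cst [LHS]big_mkcond [RHS]big_mkcond /=; apply: eq_bigr => A _.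
case: (boolP (A \in U)) => AU; first by rewrite (subsetP UF A AU) mulr1.
by rewrite mulr0; case: ifP.
Qed.

End ChainAverage.

(** * The upward entropy bound *)

Section Forward.
Local Open Scope ring_scope.
Variables (R : realType) (n k : nat) (F : {set {set 'I_n}}).
Variable V : {set {set {set 'I_n}}}.
Hypothesis V_gt0 : (0 < #|V|)%N.
Hypothesis k2 : (2 <= k)%N.
Hypothesis V_valid : forall r, r \in V -> valid_red k F r.
Variable zeta : R.
Hypotheses (zeta_gt0 : 0 < zeta) (zeta_k : 1000 * (zeta * k%:R) <= 1).
Hypothesis n_large : 160 * log2 (k%:R : R) <= zeta * n%:R.
Hypothesis kkn : (4 * k ^ 2 <= n)%N.
Implicit Types (U : {set {set 'I_n}}) (A B : {set 'I_n}) (f : max_chain n).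
Implicit Types (r : {set {set 'I_n}}).

Local Notation E := (@chain_avg R n).
Local Notation P := (fun D => avg V (fun r => (D r)%:R : R)).

Definition prob_conflict A B : R := avg V (fun r => (conflict F r A B)%:R).
Definition prob_conflict_top A : R := avg V (fun r => (conflict_top k F r A)%:R).

Definition excess f : R := #|trace F f|%:R - (k.-1)%:R.

(** Each conflict is charged to its upper set, the one whose heights may be revealed. *)
Definition conflicts_in U f : R :=
  \sum_(A in trace F f)
    if next F f A is Some B then (if B \in U then prob_conflict A B else 0) else 0.

Let prob_ge0 (D : {set {set 'I_n}} -> bool) : 0 <= P D.
Proof. by apply: avg_ge0 => // r _; rewrite ler0n. Qed.

Let prob_le1 (D : {set {set 'I_n}} -> bool) : P D <= 1.
Proof.
rewrite -[X in _ <= X](avg_cst V_gt0); apply: le_avg => // r _.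
by case: (D r); rewrite ?ler01.
Qed.

(** Small enough that 6 [xi], the price of wrong predictions on [Z], stays well below [zeta]. *)
Let xi : R := zeta / 40.

Let kR : 2 <= k%:R :> R. Proof. by rewrite ler_nat. Qed.

Let zeta_small : 1000 * zeta <= 1.
Proof. by move: kR zeta_k zeta_gt0; nra. Qed.

Let kn : (k <= n)%N.
Proof.
by apply: leq_trans kkn; rewrite mulnCA leq_pmulr // muln_gt0 /= (leq_trans _ k2).
Qed.

Let V_sub r : r \in V -> r \subset F.
Proof. by move/V_valid/and3P => []. Qed.

Section Typical.
Variables (U : {set {set 'I_n}}) (rk : {set 'I_n} -> nat).
(** The typical height [rk B] is only required to be rarely undercut: by the chains below [B] here,
    and by those above [B], with k - 2 - [rk B], in [rk_above]. Heights larger than [rk B] are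
    handled through [Z]. *)
Hypothesis rk_below : forall B, B \in F :\: U ->
  P (fun r => (height r B < rk B) || (height (F :\: r) B < rk B))%N <= xi.
Hypothesis rk_above : forall B, B \in F :\: U ->
  P (fun r => (height (dual r) (~: B) + rk B + 2 < k) ||
     (height (dual (F :\: r)) (~: B) + rk B + 2 < k))%N <= xi.

Let high B r := ((rk B < height r B) || (rk B < height (F :\: r) B))%N.
(* For [B] in [Z] the height often exceeds the typical value [rk B]. Its colour is
   then forced, because a long chain of the same colour lies above [B]. *)
Let Z := [set B in F :\: U | zeta <= P (high B)].
Let U' := U :|: Z.

Let phat A B := P (fun r => (rk B <= height r A) || (rk B <= height (F :\: r) A))%N.

(* The entropy of the colour of [A] drops by [gain_next] when the next member is
   [B]: if [B] is in [U'] its two heights are revealed, otherwise they are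
   guessed to be at most [rk B]. *)
Let gain_next f A : R :=
  if next F f A is Some B then
    if B \in U' then prob_conflict A B else Num.max 0 (24 / 25 * phat A B - 6 * zeta)
  else prob_conflict_top A.

Let gain f A : R := Num.max (gain_next f A) (if A \in Z then zeta / 2 else 0).

Let info f A : R :=
  if next F f A is Some B then (if B \in U' then pair_info R F V k B A else 0) else 0.

Let ZF : Z \subset F.
Proof. by apply/subsetP => B; rewrite inE => /andP[/setDP[]]. Qed.

Let entropy_Z A : A \in Z -> step_entropy R F V A <= 1 - zeta / 2.
Proof.
rewrite inE => /andP[AFU hA].
have AF : A \in F by case/setDP: AFU.
have inv : {in V &, forall r r', r :&: before F A = r' :&: before F A ->
    high A r = high A r' /\ ~~ (rk A < height r A)%N = ~~ (rk A < height r' A)%N}.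
  move=> r r' rV r'V /(height_before AF (V_sub rV) (V_sub r'V)) [h1 h2].
  by rewrite /high h1 h2.
apply: le_trans (step_entropy_claim R V_gt0 inv) _.
(* A wrong prediction gives [A] the colour whose height at [A] exceeds [rk A]. As that colour has no
   k-chain, its chains above [A] are too short, which [rk_above] makes rare. *)
have err : avg V (fun r => (high A r && ((A \in r) != ~~ (rk A < height r A)%N))%:R) <= xi.
  apply: le_trans (rk_above AFU); apply: le_avg => // r rV; rewrite ler_nat.
  suff imp : high A r && ((A \in r) != ~~ (rk A < height r A)%N) ->
    ((height (dual r) (~: A) + rk A + 2 < k) || (height (dual (F :\: r)) (~: A) + rk A + 2 < k))%N.
    by case: (_ && _) imp => //= ->.
  rewrite /high => /andP[h1 h2].
  have /and3P[rF lR lB] := V_valid rV.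
  have k0 : (0 < k)%N by apply: leq_trans k2.
  have bound (G : {set {set 'I_n}}) : low_heights k G -> A \in G -> (rk A < height G A)%N ->
      (height (dual G) (~: A) + rk A + 2 < k)%N.
    move=> lG AG lt; have [C CG leC] := height_dual_add AG.
    move/forallP: lG => /(_ C); rewrite CG /=; exact: dual_height_arith leC lt.
  move: h1 h2; case: (boolP (A \in r)) => Ar.
    by case: (boolP (rk A < height r A)%N) => // h _ _; rewrite (bound r lR Ar h).
  case: (boolP (rk A < height r A)%N) => //= _ h _.
  by rewrite (bound (F :\: r) lB _ h) ?orbT // in_setD Ar.
by have := zeta_gt0; move: err hA; rewrite /xi; lra.
Qed.


Let entropy_next f A : f \in max_chains n -> A \in trace F f ->
  step_entropy R F V A <= 1 - gain_next f A + info f A.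
Proof.
move=> fM At; have AF : A \in F by move: At; rewrite in_trace => /andP[].
rewrite /gain_next /info; case e : (next F f A) => [B|]; last first.
  by rewrite addr0; apply: step_entropy_top.
have [Bt AB] := next_trace fM e.
case: (boolP (B \in U')) => BU; first exact: step_entropy_pair.
have BF : B \in F by move: Bt; rewrite in_trace => /andP[].
have BFU : B \in F :\: U by move: BU; rewrite in_setD BF andbT inE negb_or => /andP[].
have highB : P (high B) < zeta.
  by move: BU; rewrite in_setU negb_or => /andP[_]; rewrite inE BFU /= -ltNge.
pose D r := ((rk B <= height r A) || (rk B <= height (F :\: r) A))%N.
have inv : {in V &, forall r r', r :&: before F A = r' :&: before F A ->
    D r = D r' /\ ~~ (rk B <= height r A)%N = ~~ (rk B <= height r' A)%N}.
  move=> r r' rV r'V /(height_before AF (V_sub rV) (V_sub r'V)) [h1 h2].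
  by rewrite /D h1 h2.
have le1 := step_entropy_claim R V_gt0 inv.
(* On a wrong guess, [A] has height at least [rk B] in its own colour, so [B] above it exceeds
   [rk B]. *)
have err : avg V (fun r => (D r && ((A \in r) != ~~ (rk B <= height r A)%N))%:R) <= P (high B).
  apply: le_avg => // r rV; rewrite ler_nat.
  suff imp : D r && ((A \in r) != ~~ (rk B <= height r A)%N) -> high B r.
    by case: (_ && _) imp => //= ->.
  rewrite /D /high => /andP[h1 h2].
  move: h1 h2; case: (boolP (A \in r)) => Ar.
    case: (boolP (rk B <= height r A)%N) => // h _ _.
    by rewrite (leq_ltn_trans h (height_lt Ar AB)).
  case: (boolP (rk B <= height r A)%N) => //= _ h _.
  by rewrite (leq_ltn_trans h (height_lt _ AB)) ?orbT // in_setD Ar.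
have le2 := step_entropy_le1 R F V_gt0 A.
rewrite addr0 -/(D) maxEle; case: ifP => _; last by rewrite subr0.
by move: le1 err highB; rewrite -[avg V (fun r => (D r)%:R)]/(phat A B); lra.
Qed.

Let info_ge0 f A : 0 <= info f A.
Proof. by rewrite /info; case: next => // B; case: ifP => // _; apply: pair_info_ge0. Qed.

Let entropy_gain f A : f \in max_chains n -> A \in trace F f ->
  step_entropy R F V A <= 1 - gain f A + info f A.
Proof.
move=> fM At; rewrite /gain maxEle; case: ifP => _; last exact: entropy_next.
have := info_ge0 f A; case: ifP => [/entropy_Z|_]; first lra.
have := step_entropy_le1 R F V_gt0 A; lra.
Qed.

Let gain_next_le1 f A : gain_next f A <= 1.
Proof.
rewrite /gain_next; case: next => [B|]; last exact: prob_le1.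
case: ifP => _; first exact: prob_le1.
rewrite ge_max ler01 /=.
have := prob_le1 (fun r => (rk B <= height r A) || (rk B <= height (F :\: r) A))%N.
by rewrite -/(phat A B); have := zeta_gt0; lra.
Qed.

Let gain01 f A : 0 <= 1 - gain f A <= 1.
Proof.
have z1 : zeta / 2 <= 1 by have := zeta_small; lra.
rewrite /gain subr_ge0 gerBl ge_max le_max gain_next_le1 /=.
case: ifP => _; last by rewrite ler01 lexx orbT.
by rewrite z1; apply/orP; right; have := zeta_gt0; lra.
Qed.

Let gain_sum f := \sum_(A in trace F f) gain f A.

Lemma card_trace_le f : f \in max_chains n -> (#|trace F f| <= k.-1.*2)%N.
Proof.
move=> fM; have [r rV] : exists r, r \in V by apply/card_gt0P.
apply: leq_trans (sum_conflict k2 (V_valid rV) fM).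
by rewrite -sum1_card; apply: leq_sum => A _.
Qed.

Let conflict_sum f : f \in max_chains n -> 2 * excess f <=
  \sum_(A in trace F f) if next F f A is Some B then prob_conflict A B else prob_conflict_top A.
Proof.
move=> fM.
rewrite (eq_bigr (fun A => avg V (fun r => (conflict_next k F r f A)%:R))); last first.
  by move=> A _; rewrite /conflict_next; case: next.
rewrite -avg_sum -[X in X <= _](avg_cst V_gt0); apply: le_avg => // r rV.
have := sum_conflict k2 (V_valid rV) fM.
rewrite -(ler_nat R) natr_sum => h.
have e : \sum_(A in trace F f) ((~~ conflict_next k F r f A).+1)%:R =
   2 * #|trace F f|%:R - \sum_(A in trace F f) (conflict_next k F r f A)%:R :> R.
  rewrite -sum1_card natr_sum mulr_sumr -sumrB; apply: eq_bigr => A _.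
  by case: conflict_next => /=; lra.
by move: h; rewrite e -muln2 natrM /excess; lra.
Qed.

(** The guess misses a conflict only if a height of [B] is below [rk B]. The loss is 6 [zeta] for
    wrong guesses, and one more [zeta] covers the missed conflicts. *)
Let gain_next_conflict f A : f \in max_chains n -> A \in trace F f ->
  24 / 25 * (if next F f A is Some B then prob_conflict A B else prob_conflict_top A)
    - 7 * zeta <= gain_next f A.
Proof.
move=> fM At; rewrite /gain_next; case e : (next F f A) => [B|]; last first.
  have := prob_ge0 (fun r => conflict_top k F r A).
  by rewrite -/(prob_conflict_top A); have := zeta_gt0; lra.
have c0 := prob_ge0 (fun r => conflict F r A B); rewrite -/(prob_conflict A B) in c0.
case: (boolP (B \in U')) => BU; first by have := zeta_gt0; lra.
have [Bt AB] := next_trace fM e.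
have BF : B \in F by move: Bt; rewrite in_trace => /andP[].
have BFU : B \in F :\: U by move: BU; rewrite in_setD BF andbT inE negb_or => /andP[].
have le : prob_conflict A B <= phat A B + xi.
  apply: (@le_trans _ _ (phat A B +
      P (fun r => (height r B < rk B) || (height (F :\: r) B < rk B))%N)); last first.
    by rewrite lerD2l; apply: rk_below.
  rewrite -avgD; apply: le_avg => // r rV; rewrite -natrD ler_nat /conflict.
  exact: conflict_rank_arith.
rewrite le_max; apply/orP; right.
by move: le; rewrite /xi; have := zeta_gt0; lra.
Qed.

(** A trace has at most 2k members, so the loss is at most 14 zeta k <= 0.014. A positive excess is
    at least 1, so the factor 48/25 drops at most to 19/10. *)
Let gain_sum_excess f : f \in max_chains n -> 0 <= excess f ->
  19 / 10 * excess f <= gain_sum f.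
Proof.
move=> fM; rewrite le_eqVlt => /predU1P[<-|x0].
  rewrite mulr0 sumr_ge0 // => A _; have /andP[_] := gain01 f A; lra.
have x1 : 1 <= excess f.
  move: x0; rewrite /excess subr_gt0 ltr_nat => h.
  by rewrite lerBrDr addrC natr1 ler_nat.
have tk : #|trace F f|%:R <= 2 * k%:R :> R.
  rewrite -natrM ler_nat; apply: leq_trans (card_trace_le fM) _.
  by rewrite mul2n leq_double leq_pred.
have := conflict_sum fM; set c := \sum_(A in _) _ => hc.
apply: (@le_trans _ _ (24 / 25 * c - 7 * zeta * #|trace F f|%:R)).
  have : zeta * #|trace F f|%:R <= zeta * (2 * k%:R) by rewrite ler_pM2l.
  by move: zeta_k; lra.
rewrite /c mulr_sumr -sum1_card natr_sum mulr_sumr -sumrB; apply: ler_sum => A At.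
rewrite mulr1; apply: le_trans (gain_next_conflict fM At) _.
by rewrite /gain le_max lexx.
Qed.

Let gain_sum_U f : f \in max_chains n -> conflicts_in U f <= gain_sum f.
Proof.
move=> fM; apply: ler_sum => A At; rewrite /gain le_max; apply/orP; left.
rewrite /gain_next; case: next => [B|]; last exact: prob_ge0.
rewrite /U' in_setU; case: (B \in U) => //=.
case: ifP => _; first exact: prob_ge0.
by rewrite le_max lexx.
Qed.

Let gain_sum_Z f : zeta / 2 * #|trace F f :&: Z|%:R <= gain_sum f.
Proof.
rewrite -sum1_card natr_sum mulr_sumr.
rewrite (eq_bigl (fun A => (A \in trace F f) && (A \in Z))); last by move=> A; rewrite in_setI.
rewrite big_mkcondr; apply: ler_sum => A At; rewrite mulr1.
by rewrite /gain le_max lexx orbT.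
Qed.

(** Split the gain as 8/10 + 1/10 + 1/10. The first share outweighs a nonnegative excess, the others
    reward conflicts in [U] and members of [Z]. A negative excess is already minus its absolute
    value. *)
Let gain_balance f : f \in max_chains n -> excess f - gain_sum f <=
  - (2 / 5) * `|excess f| - 10^-1 * conflicts_in U f - zeta / 20 * #|trace F f :&: Z|%:R.
Proof.
move=> fM; have h1 := gain_sum_U fM; have h2 := gain_sum_Z f.
have z : 0 <= zeta * #|trace F f :&: Z|%:R by rewrite mulr_ge0 ?ler0n // ltW.
have u : 0 <= conflicts_in U f.
  apply: sumr_ge0 => A _; case: next => // B; case: ifP => // _; exact: prob_ge0.
case: (ger0P (excess f)) => x; last lra.
have := gain_sum_excess fM x; lra.
Qed.

(** The weight C(n, |A|) cancels the probability of meeting [A], and a chain through [A] meets [B]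
    with probability at most 1 / (n - |B| + 1). Summed over [A], the information is at most the 2
    log2 k bits of one height pair. *)
Let info_cost : E (fun f => \sum_(A in trace F f) 'C(n, #|A|)%:R * info f A) <=
  low_bin R n k * (8 * log2 (k%:R : R) / n%:R * density R U').
Proof.
have n0 : 0 < n%:R :> R by rewrite ltr0n (leq_trans _ kn) // (leq_trans _ k2).
have M0 : 0 < #|max_chains n|%:R :> R by rewrite ltr0n max_chains_gt0.
rewrite chain_avg_trace.
apply: (@le_trans _ _ (\sum_(A in F) \sum_(B in U' | A \proper B)
   (n - #|B|).+1%:R^-1 * pair_info R F V k B A)).
  apply: ler_sum => A AF.
  apply: (@le_trans _ _ (#|max_chains n|%:R^-1 * \sum_(f in through A)
     \sum_(B in U' | A \proper B) (meets f B)%:R * ('C(n, #|A|)%:R * pair_info R F V k B A))).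
    rewrite ler_pM2l ?invr_gt0 //; apply: ler_sum => f fA.
    have fM := through_max_chains fA.
    have pos B : 0 <= (meets f B)%:R * ('C(n, #|A|)%:R * pair_info R F V k B A).
      by rewrite !mulr_ge0 ?ler0n // pair_info_ge0.
    rewrite /info; case e : (next F f A) => [B|]; last by rewrite mulr0 sumr_ge0.
    case: ifP => BU; last by rewrite mulr0 sumr_ge0.
    have [Bt AB] := next_trace fM e.
    rewrite (bigD1 B) ?BU //= (_ : meets f B); last by move: Bt; rewrite in_trace => /andP[].
    by rewrite mul1r lerDl sumr_ge0.
  rewrite exchange_big mulr_sumr; apply: ler_sum => B /andP[BU AB].
  rewrite -mulr_suml mulrA mulrA ler_wpM2r ?pair_info_ge0 //.
  have -> : \sum_(f in through A) (meets f B)%:R = #|through A :&: through B|%:R :> R.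
    rewrite -sum1_card natr_sum big_mkcond [RHS]big_mkcond; apply: eq_bigr => f _ /=.
    by rewrite in_setI !in_through; case: (f \in _); case: meets => //; case: meets.
  rewrite ler_pdivrMl // ler_pdivlMr ?ltr0n // -!natrM ler_nat.
  rewrite mulnAC -(card_through A) leq_mul2r; apply/orP; right.
  exact: card_through2_le.
rewrite (exchange_big_dep (mem U')) /=; last by move=> A B _ /andP[].
rewrite /density !mulr_sumr; apply: ler_sum => B BU.
apply: (@le_trans _ _ ((n - #|B|).+1%:R^-1 * (2 * log2 (k%:R : R)))).
  rewrite -mulr_sumr ler_pM2l ?invr_gt0 ?ltr0n //.
  apply: (@le_trans _ _ (\sum_(A in F) pair_info R F V k B A)); last exact: sum_pair_info.
  rewrite [X in _ <= X](bigID (fun A => (B \in U') && (A \proper B))) /= lerDl.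
  by apply: sumr_ge0 => A _; apply: pair_info_ge0.
have lg := log2_ge1 R k2.
have key : (n * 'C(n, #|B|) <= 4 * 'C(n, low_level n k) * (n - #|B|).+1)%N.
  exact: bin_cost_arith (card_lt B) (bin_le_twice_low k2 kn kkn).
have keyR : n%:R * 'C(n, #|B|)%:R <= 4 * low_bin R n k * (n - #|B|).+1%:R.
  by rewrite /low_bin -!natrM ler_nat.
have c0 := bin_card_gt0 R B; have m0 : 0 < (n - #|B|).+1%:R :> R by rewrite ltr0n.
rewrite /chain_prob; move: keyR c0 m0 lg.
move: (log2 _) 'C(n, #|B|)%:R (n - #|B|).+1%:R => l c m keyR c0 m0 lg.
rewrite -subr_ge0.
have -> : low_bin R n k * (8 * l / n%:R * c^-1) - m^-1 * (2 * l) =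
    (4 * low_bin R n k * m - n%:R * c) * (2 * l) / (n%:R * c * m).
  by field; rewrite ?gt_eqF //.
apply: divr_ge0; last by rewrite ltW // !mulr_gt0.
by apply: mulr_ge0; [rewrite subr_ge0|lra].
Qed.

Lemma forward_bound : log2 (#|V|%:R : R) <= (middle_levels_size n k)%:R +
  low_bin R n k * (- (2 / 5) * E (fun f => `|excess f|) - 10^-1 * E (conflicts_in U)
    + 8 * log2 (k%:R : R) / n%:R * density R U).
Proof.
have n0 : 0 < n%:R :> R by rewrite ltr0n (leq_trans _ kn) // (leq_trans _ k2).
have M0 := max_chains_gt0 n.
have mu0 := low_bin_gt0 R k2 kn.
rewrite -(sum_step_entropy R V_gt0 V_sub).
have -> : \sum_(A in F) step_entropy R F V A =
    E (fun f => \sum_(A in trace F f) 'C(n, #|A|)%:R * step_entropy R F V A).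
  rewrite chain_avg_trace_cst; apply: eq_bigr => A _.
  by rewrite mulrA mulVf ?mul1r // gt_eqF // bin_card_gt0.
apply: (@le_trans _ _ (E (fun f => \sum_(A in trace F f) 'C(n, #|A|)%:R * (1 - gain f A)) +
   E (fun f => \sum_(A in trace F f) 'C(n, #|A|)%:R * info f A))).
  rewrite -avgD; apply: le_avg => // f fM; rewrite -big_split /=; apply: ler_sum => A At.
  by rewrite -mulrDr ler_pM2l ?bin_card_gt0 // entropy_gain.
apply: le_trans (lerD _ info_cost) _.
  apply: (@le_trans _ _ (E (fun f => (middle_levels_size n k)%:R + low_bin R n k *
    (- (2 / 5) * `|excess f| - 10^-1 * conflicts_in U f - zeta / 20 * #|trace F f :&: Z|%:R)))).
    apply: le_avg => // f fM.
    apply: le_trans (trace_weight k2 kn fM (fun A _ => gain01 f A)) _.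
    rewrite lerD2l ler_pM2l //; apply: le_trans (gain_balance fM).
    rewrite sumrB sumr_const /gain_sum /excess; lra.
  exact: lexx.
rewrite /chain_avg avgD (avg_cst M0) avgZ 2!avgB !avgZ -/(chain_avg _).
rewrite -addrA lerD2l -mulrDr ler_pM2l //.
have -> : avg (max_chains n) (fun f => #|trace F f :&: Z|%:R) = density R Z.
  exact: chain_avg_density.
have dU : density R U' = density R U + density R Z.
  have dis : [disjoint U & Z].
    rewrite -setI_eq0; apply/eqP/setP => A; rewrite !inE.
    by case: (A \in U); rewrite ?andbF.
  by rewrite /density -bigU //; apply: eq_bigl => A; rewrite in_setU.
rewrite dU mulrDr.
(* Revealing heights on [Z] is paid for by the gain on [Z] itself, thanks to [n_large]; only the
   cost of [U] remains. *)
have : 8 * log2 (k%:R : R) / n%:R * density R Z <= zeta / 20 * density R Z.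
  apply: ler_wpM2r; first exact: density_ge0.
  by rewrite ler_pdivrMr //; move: n_large; lra.
rewrite -/(chain_avg _) /chain_avg; lra.
Qed.

End Typical.
End Forward.

(** * Typical heights *)

Section LocalConflicts.
Local Open Scope ring_scope.
Variables (R : realType) (n : nat) (F : {set {set 'I_n}}).
Variable V : {set {set {set 'I_n}}}.
Hypothesis V_gt0 : (0 < #|V|)%N.
Implicit Types (U : {set {set 'I_n}}) (A B C : {set 'I_n}) (f g : max_chain n).
Implicit Types (r : {set {set 'I_n}}).

Local Notation pc := (prob_conflict R F V).

(** At most one term is nonzero, that of the predecessor of [B] on [f]. *)
Definition conflict_at B f : R :=
  \sum_(A in F) (consecutive F f A B)%:R * pc A B.

(** Since [conflict_at B] vanishes on chains avoiding [B], this is its conditional expectation given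
    that the chain meets [B]. *)
Definition conflict_rate B : R := chain_avg (conflict_at B) / chain_prob R B.

Lemma prob_conflict_ge0 A B : 0 <= pc A B.
Proof. by apply: avg_ge0 => // r _; rewrite ler0n. Qed.

Lemma conflict_at_ge0 B f : 0 <= conflict_at B f.
Proof. by apply: sumr_ge0 => A _; rewrite mulr_ge0 ?ler0n ?prob_conflict_ge0. Qed.

Lemma conflicts_inE U f : f \in max_chains n ->
  conflicts_in R F V U f = \sum_(B in F | B \in U) conflict_at B f.
Proof.
move=> fM; rewrite /conflict_at exchange_big /= /conflicts_in.
rewrite [RHS](bigID (fun A => meets f A)) /= [X in _ = _ + X]big1 ?addr0; last first.
  move=> A /andP[_ nA]; apply: big1 => B _.
  by rewrite /consecutive in_trace (negbTE nA) andbF mul0r.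
apply: eq_big => [A|A _]; first by rewrite in_trace.
case e : (next F f A) => [B|]; last first.
  by rewrite big1 // => B _; rewrite -nextP // e /= mul0r.
have [Bt _] := next_trace fM e.
have BF : B \in F by move: Bt; rewrite in_trace => /andP[].
have z C : C != B -> (consecutive F f A C)%:R * pc A C = 0.
  move=> CB; rewrite -nextP // e; have -> : (Some B == Some C) = false.
    by apply/eqP => -[eBC]; rewrite eBC eqxx in CB.
  by rewrite mul0r.
case: ifP => BU; last first.
  rewrite big1 // => C /andP[_ CU]; apply: z; apply: contraTneq CU => ->.
  by rewrite BU.
rewrite (bigD1 B) ?BF //= big1 ?addr0; last by move=> C /andP[_]; apply: z.
by rewrite -nextP // e eqxx mul1r.
Qed.

Lemma conflicts_in_ge0 U f : 0 <= conflicts_in R F V U f.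
Proof.
apply: sumr_ge0 => A _; case: next => // B; case: ifP => // _.
exact: prob_conflict_ge0.
Qed.

Lemma conflict_at_meets B f : conflict_at B f = (meets f B)%:R * conflict_at B f.
Proof.
case: (boolP (meets f B)) => mB; first by rewrite mul1r.
rewrite mul0r; apply: big1 => A _.
by rewrite /consecutive !in_trace (negbTE mB) !andbF mul0r.
Qed.

Lemma conflict_at_low B f g : f \in through B -> g \in through B ->
  (forall i : 'I_n.+1, (i <= #|B|)%N -> f i = g i) -> conflict_at B f = conflict_at B g.
Proof.
move=> fB gB fg.
have mE A : (#|A| <= #|B|)%N -> meets f A = meets g A.
  by move=> AB; rewrite /meets fg // inordK ?card_lt.
apply: eq_bigr => A _; congr (_%:R * _); rewrite /consecutive !in_trace.
case: (boolP (A \proper B)) => AB; last by rewrite !andbF.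
have leAB : (#|A| <= #|B|)%N by rewrite ltnW // proper_card.
rewrite !mE //; congr (_ && _); congr (_ && _); congr (_ && _).
apply/forallP/forallP => no C; have := no C; rewrite !in_trace;
  case: (boolP (C \proper B)) => CB; rewrite ?andbF ?implybT //.
  by rewrite mE // ltnW // proper_card.
by rewrite mE // ltnW // proper_card.
Qed.

Lemma sum_conflict_at B :
  \sum_(f in through B) conflict_at B f = #|through B|%:R * conflict_rate B.
Proof.
have M0 : #|max_chains n|%:R != 0 :> R by rewrite pnatr_eq0 -lt0n max_chains_gt0.
have t0 : #|through B|%:R != 0 :> R by rewrite pnatr_eq0 -lt0n through_gt0.
rewrite /conflict_rate chain_probE /chain_avg /avg.
have -> : \sum_(f in max_chains n) conflict_at B f = \sum_(f in through B) conflict_at B f.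
  rewrite big_mkcond [RHS]big_mkcond; apply: eq_bigr => f _ /=.
  rewrite in_through; case: (f \in _) => //=.
  by rewrite conflict_at_meets; case: meets; rewrite ?mul0r.
by field; rewrite M0 t0.
Qed.

(* Markov property: the part of the chain above [B] does not affect the
   conflicts at [B]. *)
Lemma conflict_at_through B B' : B' \subset B ->
  \sum_(f in through B) conflict_at B' f =
  conflict_rate B' * \sum_(f in through B) (meets f B')%:R.
Proof.
move=> B'B.
have t0 : #|through B'|%:R != 0 :> R by rewrite pnatr_eq0 -lt0n through_gt0.
have swap (X : max_chain n -> R) : \sum_(f in through B) (meets f B')%:R * X f =
    \sum_(f in through B') X f * (meets f B)%:R.
  rewrite big_mkcond [RHS]big_mkcond; apply: eq_bigr => f _ /=.
  rewrite !in_through; case: (f \in _) => //=.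
  by case: (meets f B); case: (meets f B'); rewrite ?mulr1 ?mulr0 ?mul1r ?mul0r.
rewrite (eq_bigr (fun f => (meets f B')%:R * conflict_at B' f)); last first.
  by move=> f _; rewrite -conflict_at_meets.
rewrite swap.
have -> : \sum_(f in through B) (meets f B')%:R = \sum_(f in through B') (meets f B)%:R :> R.
  transitivity (\sum_(f in through B) (meets f B')%:R * (1 : R)).
    by apply: eq_bigr => f _; rewrite mulr1.
  by rewrite (swap (fun=> 1)); apply: eq_bigr => f _; rewrite mul1r.
apply: (mulIf t0).
rewrite (@through_indep _ _ _ (conflict_at B') (fun f => (meets f B)%:R)).
- by rewrite sum_conflict_at; ring.
- exact: conflict_at_low.
- move=> f g fB gB fg; rewrite /meets fg // inordK ?card_lt //.
  exact: subset_leq_card.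
Qed.

Lemma chain_avg_conflicts_in U : U \subset F ->
  chain_avg (conflicts_in R F V U) = \sum_(B in U) chain_prob R B * conflict_rate B.
Proof.
move=> UF; rewrite /chain_avg (eq_avg (g := fun f => \sum_(B in F | B \in U) conflict_at B f)).
  rewrite avg_sum; apply: eq_big => [B|B _].
    by apply: andb_idl => /(subsetP UF).
  by rewrite /conflict_rate mulrCA divff ?mulr1 // gt_eqF // chain_prob_gt0.
by move=> f fM; rewrite conflicts_inE.
Qed.

Definition conflicts_below B : R :=
  avg (through B) (conflicts_in R F V [set C : {set 'I_n} | C \subset B]).

(** By the Markov property, the sets outside [U] contribute at most [kappa] times the expected
    number of members met. *)
Lemma conflicts_below_le U (kappa : R) (m : nat) B : B \in F ->
  (forall f, f \in max_chains n -> (#|trace F f| <= m)%N) -> 0 <= kappa ->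
  (forall C, C \in F :\: U -> conflict_rate C <= kappa) ->
  conflicts_below B <= avg (through B) (conflicts_in R F V U) + kappa * m%:R.
Proof.
move=> BF trm kap0 rate.
have tg := through_gt0 B.
apply: (@le_trans _ _ (avg (through B) (conflicts_in R F V U) +
  avg (through B) (fun f => \sum_(C in F :\: U | C \subset B) conflict_at C f))).
  rewrite -avgD; apply: le_avg => // f /through_max_chains fM.
  rewrite !conflicts_inE // (bigID (fun C => C \in U)) /=; apply: lerD.
    rewrite [X in _ <= X](bigID (fun C => C \subset B)) /= -[X in X <= _]addr0.
    apply: lerD; last by apply: sumr_ge0 => C _; apply: conflict_at_ge0.
    rewrite le_eqVlt; apply/orP; left; apply/eqP; apply: eq_bigl => C.
    by rewrite inE -!andbA; congr andb; rewrite andbC.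
  rewrite le_eqVlt; apply/orP; left; apply/eqP; apply: eq_bigl => C.
  by rewrite inE in_setD; case: (_ \in F); case: (_ \in U); rewrite ?andbF ?andbT.
rewrite lerD2l avg_sum.
apply: (@le_trans _ _ (\sum_(C in F :\: U | C \subset B)
   kappa * avg (through B) (fun f => (meets f C)%:R))).
  apply: ler_sum => C /andP[CFU CB]; rewrite /avg conflict_at_through // mulrCA.
  by rewrite ler_wpM2r ?rate // mulr_ge0 ?invr_ge0 ?ler0n // sumr_ge0.
rewrite -mulr_sumr ler_wpM2l // -avg_sum -[X in _ <= X](avg_cst tg).
apply: le_avg => // f /through_max_chains fM.
apply: (@le_trans _ _ #|trace F f|%:R); last by rewrite ler_nat trm.
rewrite -sum1_card natr_sum [X in _ <= X]big_mkcond [X in X <= _]big_mkcond /=.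
apply: ler_sum => C _; rewrite in_trace in_setD.
by case: (C \in F); case: (C \in U) => //=; case: (C \subset B) => //=; case: meets; rewrite ?ler01.
Qed.

Definition low_at B m r := (height r B < m)%N || (height (F :\: r) B < m)%N.

(** A union bound: by [position_le_height], a height below the position of [B] requires a conflict
    at or below [B]. *)
Lemma low_at_position f r B : f \in through B -> B \in F -> r \subset F ->
  (low_at B (position F f B) r)%:R <=
  \sum_(A in F) \sum_(C in F | C \subset B) (consecutive F f A C && conflict F r A C)%:R :> R.
Proof.
move=> fB BF rF; have fM := through_max_chains fB.
have Bt : B \in trace F f by rewrite in_trace BF; move: fB; rewrite in_through => /andP[].
have pos0 (A : {set 'I_n}) : A \in F -> 0 <= \sum_(C in F | C \subset B)
   (consecutive F f A C && conflict F r A C)%:R :> R.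
  by move=> _; apply: sumr_ge0 => C _; rewrite ler0n.
case: (boolP (low_at _ _ _)) => low; last by rewrite sumr_ge0.
case: (boolP [exists A, exists C, [&& consecutive F f A C, C \subset B & conflict F r A C]]).
  move=> /existsP[A /existsP[C /and3P[cAC CB con]]].
  have /and4P[At Ct _ _] := cAC.
  have AF : A \in F by move: At; rewrite in_trace => /andP[].
  have CF : C \in F by move: Ct; rewrite in_trace => /andP[].
  rewrite (bigD1 A) //= (bigD1 C) ?CF //= cAC con /= -addrA lerDl addr_ge0 //.
    by apply: sumr_ge0 => D _; rewrite ler0n.
  by apply: sumr_ge0 => D /andP[DF _]; apply: pos0.
rewrite negb_exists => /forallP no; exfalso.
have nc A A' : consecutive F f A A' -> A' \subset B -> ~~ conflict F r A A'.
  move=> cA A'B; have := no A; rewrite negb_exists => /forallP/(_ A').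
  by rewrite cA A'B.
have /andP[h1 h2] := position_le_height fM Bt rF nc.
by move: low; rewrite /low_at !ltnNge h1 h2.
Qed.


Lemma low_at_position_avg B : B \in F -> (forall r, r \in V -> r \subset F) ->
  avg (through B) (fun f => avg V (fun r => (low_at B (position F f B) r)%:R)) <=
  conflicts_below B.
Proof.
move=> BF VF; apply: le_avg; first exact: through_gt0.
move=> f fB; have fM := through_max_chains fB.
apply: (@le_trans _ _ (avg V (fun r => \sum_(A in F) \sum_(C in F | C \subset B)
   (consecutive F f A C && conflict F r A C)%:R))).
  by apply: le_avg => // r rV; apply: low_at_position => //; apply: VF.
rewrite avg_sum conflicts_inE // [X in _ <= X](eq_bigl (fun C => (C \in F) && (C \subset B))).
  rewrite /conflict_at exchange_big /=; apply: ler_sum => A _.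
  rewrite avg_sum; apply: ler_sum => C _.
  rewrite -avgZ; apply: le_avg => // r _.
  by case: consecutive => /=; rewrite ?mul1r ?mul0r.
by move=> C; rewrite inE.
Qed.

End LocalConflicts.

Section AvgInvolution.
Local Open Scope ring_scope.
Variables (R : realType) (W W' : finType).

Lemma avg_involutive (Om Om' : {set W}) (h : W -> W) (X : W -> R) :
  involutive h -> (forall w, (h w \in Om') = (w \in Om)) ->
  avg Om' X = avg Om (fun w => X (h w)).
Proof.
move=> hK hO.
have cO : #|Om| = #|Om'|.
  rewrite -(card_imset _ (inv_inj hK)); apply: eq_card => w.
  rewrite -(hK w) hO; exact: mem_imset (inv_inj hK).
rewrite /avg cO; congr (_ * _).
by rewrite (reindex_inj (inv_inj hK)) /=; apply: eq_bigl => w; rewrite hO.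
Qed.

Lemma avg_swap (Om : {set W}) (Om' : {set W'}) (X : W -> W' -> R) :
  avg Om (fun w => avg Om' (fun w' => X w w')) =
  avg Om' (fun w' => avg Om (fun w => X w w')).
Proof.
rewrite /avg -!mulr_sumr mulrCA; congr (_ * (_ * _)); exact: exchange_big.
Qed.

End AvgInvolution.

(** Read a, d as the positions of [B] counted from below and from above, and s, u as its heights in
    its own colour. Then a + d = k - 2 >= s + u forces equality. *)
Lemma rank_arith (t a d k s u : nat) : t = (a + d).+1 -> t = k.-1 -> a <= s -> d <= u ->
  s + u + 2 <= k -> a = s.
Proof. lia. Qed.

Lemma rank_arith_dual (t a d k u : nat) : t = (a + d).+1 -> t = k.-1 ->
  u < k - 2 - a -> u < d.
Proof. lia. Qed.

Lemma rank_arith_height (k h u c : nat) : h + u <= c -> c.+1 < k -> h + u + 2 <= k.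
Proof. lia. Qed.

(** * Complementation of colourings *)

Section DualFamily.
Variables (n k : nat) (F : {set {set 'I_n}}).
Implicit Types (r G : {set {set 'I_n}}).

Lemma dualD r : dual (F :\: r) = dual F :\: dual r.
Proof. by apply/setP => A; rewrite -(setCK A) in_setD !in_dual in_setD. Qed.

Lemma dual_sub r : (dual r \subset dual F) = (r \subset F).
Proof.
apply/subsetP/subsetP => sub A; first by have := sub (~: A); rewrite !in_dual.
by rewrite -(setCK A) !in_dual; apply: sub.
Qed.

Lemma dual_low_heights G : low_heights k G -> low_heights k (dual G).
Proof.
move=> /forallP lG; apply/forallP => A; rewrite -(setCK A) in_dual; apply/implyP => AG.
have [C CG leC] := height_dual_add AG.
have := lG C; rewrite CG /=; apply: leq_ltn_trans; rewrite ltnS.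
exact: leq_trans (leq_addl _ _) leC.
Qed.

Lemma dual_valid r : valid_red k F r -> valid_red k (dual F) (dual r).
Proof.
move=> /and3P[rF lR lB]; apply/and3P; split; first by rewrite dual_sub.
  exact: dual_low_heights.
by rewrite -dualD; apply: dual_low_heights.
Qed.

Definition dual_set (V : {set {set {set 'I_n}}}) := [set r | dual r \in V].

Lemma in_dual_set V r : (dual r \in dual_set V) = (r \in V).
Proof. by rewrite inE dualK. Qed.

End DualFamily.

(** * Existence of a typical height *)

Section Rank.
Local Open Scope ring_scope.
Variables (R : realType) (n k : nat) (F : {set {set 'I_n}}).
Variable V : {set {set {set 'I_n}}}.
Hypothesis V_gt0 : (0 < #|V|)%N.
Hypothesis k2 : (2 <= k)%N.
Hypothesis V_valid : forall r, r \in V -> valid_red k F r.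
Implicit Types (A B : {set 'I_n}) (f : max_chain n) (r : {set {set 'I_n}}).

Local Notation P := (fun D => avg V (fun r => (D r)%:R : R)).

Lemma avg_dual_set (X : {set {set 'I_n}} -> R) :
  avg (dual_set V) X = avg V (fun r => X (dual r)).
Proof. by apply: avg_involutive; [exact: dualK|move=> r; exact: in_dual_set]. Qed.

Lemma avg_through_dual B (X : max_chain n -> R) :
  avg (through (~: B)) X = avg (through B) (fun f => X (dual_chain f)).
Proof.
apply: avg_involutive; first exact: dual_chainK.
by move=> f; rewrite !in_through dual_chain_in dual_chain_meets.
Qed.

Lemma excess_ge1 f : #|trace F f| != k.-1 -> 1 <= `|excess R k F f|.
Proof.
rewrite /excess neq_ltn => /orP[]; rewrite -(ler_nat R) -natr1 => h.
  by rewrite distrC ger0_norm ?subr_ge0 //; lra.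
by rewrite ger0_norm ?subr_ge0 //; lra.
Qed.

(** Some colouring [r0] has its rank equal to the position on all but a share [e] of the chains; its
    rank is taken as [m]. A height below [m] then means a position different from [m] or a height
    below the position, hence 2e. *)
Lemma exists_rank B (e : R) : B \in F ->
  avg (through B) (fun f => `|excess R k F f|) + conflicts_below R F V B
    + conflicts_below R (dual F) (dual_set V) (~: B) <= e ->
  exists m : nat, [/\ (m + 2 <= k)%N, P (low_at F B m) <= 2 * e &
     P (fun r => low_at (dual F) (~: B) (k - 2 - m) (dual r)) <= 2 * e].
Proof.
move=> BF le_e.
have tg := through_gt0 B.
have V_sub r : r \in V -> r \subset F by move/V_valid/and3P => [].
pose pos f := position F f B.
pose posd f := position (dual F) (dual_chain f) (~: B).
pose dn f r := low_at F B (pos f) r.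
pose up f r := low_at (dual F) (~: B) (posd f) (dual r).
(* In the colour of [B], the set [B] itself joins the chains below and above it, so the two heights
   add up to at most k - 2. *)
pose rank r := if B \in r then height r B else height (F :\: r) B.
have dn_le : avg (through B) (fun f => P (dn f)) <= conflicts_below R F V B.
  exact: low_at_position_avg.
have up_le : avg (through B) (fun f => P (up f)) <=
    conflicts_below R (dual F) (dual_set V) (~: B).
  have dV0 : (0 < #|dual_set V|)%N.
    have [r rV] : exists r, r \in V by apply/card_gt0P.
    by apply/card_gt0P; exists (dual r); rewrite in_dual_set.
  apply: le_trans (low_at_position_avg R dV0 (_ : ~: B \in dual F) _).
  - by rewrite avg_through_dual; apply: le_avg => // f _; rewrite avg_dual_set.
  - by rewrite in_dual.
  - by move=> r; rewrite -(dualK r) in_dual_set dual_sub; apply: V_sub.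
have ex_ge0 : 0 <= avg (through B) (fun f => `|excess R k F f|).
  by apply: avg_ge0 => // f _.
have dn_ge0 : 0 <= avg (through B) (fun f => P (dn f)).
  by apply: avg_ge0 => // f _; apply: avg_ge0 => // r _; rewrite ler0n.
have up_ge0 : 0 <= avg (through B) (fun f => P (up f)).
  by apply: avg_ge0 => // f _; apply: avg_ge0 => // r _; rewrite ler0n.
have low_k r : r \in V ->
    (rank r + height (dual (if B \in r then r else F :\: r)) (~: B) + 2 <= k)%N.
  move=> rV; have /and3P[_ lR lB] := V_valid rV; rewrite /rank.
  have key G : low_heights k G -> B \in G -> (height G B + height (dual G) (~: B) + 2 <= k)%N.
    move=> /forallP lG BG; have [C CG leC] := height_dual_add BG.
    have := lG C; rewrite CG /=; exact: rank_arith_height leC.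
  by case: (boolP (B \in r)) => Br; apply: key => //; rewrite in_setD Br.
have point f r : f \in through B -> r \in V ->
    (pos f != rank r)%:R <= `|excess R k F f| + (dn f r)%:R + (up f r)%:R :> R.
  move=> fB rV; have fM := through_max_chains fB.
  have Bt : B \in trace F f by rewrite in_trace BF; move: fB; rewrite in_through => /andP[].
  have := normr_ge0 (excess R k F f) => x0.
  case: eqVneq => [_|ne] /=; first by rewrite !addr_ge0 // ler0n.
  case: (eqVneq #|trace F f| k.-1) => [tk|tk]; last first.
    by rewrite -addrA (le_trans (excess_ge1 tk)) // lerDl addr_ge0 // ler0n.
  case: (boolP (dn f r)) => d; first by rewrite -addrAC lerDr addr_ge0 // ler0n.
  case: (boolP (up f r)) => u; first by rewrite lerDr addr_ge0 // ler0n.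
  case/eqP: ne; move: d u; rewrite /dn /up /low_at -!dualD !negb_or -!leqNgt.
  move=> /andP[d1 d2] /andP[u1 u2].
  apply: (rank_arith (card_trace_split fM Bt) tk _ _ (low_k r rV)).
    by rewrite /rank; case: ifP.
  by case: ifP.
have [r0 r0V le0] : exists2 r, r \in V &
    avg (through B) (fun f => (pos f != rank r)%:R) <= e.
  have [r rV le_r] := exists_avg_le V_gt0
    (fun r => avg (through B) (fun f => (pos f != rank r)%:R : R)).
  exists r => //; apply: le_trans le_r _; apply: le_trans le_e.
  apply: (@le_trans _ _ (avg (through B) (fun f => `|excess R k F f|)
    + avg (through B) (fun f => P (dn f)) + avg (through B) (fun f => P (up f)))).
    rewrite avg_swap -!avgD; apply: le_avg => // f fB.
    rewrite -[X in _ <= X + _ + _](avg_cst V_gt0) -!avgD; apply: le_avg => // r' r'V.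
    exact: point.
  by apply: lerD => //; apply: lerD.
have m_k : (rank r0 + 2 <= k)%N.
  by apply: leq_trans (low_k r0 r0V); rewrite leq_add2r leq_addr.
exists (rank r0); split => //.
  apply: (@le_trans _ _ (avg (through B) (fun f => (pos f != rank r0)%:R) +
     avg (through B) (fun f => P (dn f)))); last by lra.
  rewrite [X in _ + X]avg_swap -[X in X + _](avg_cst V_gt0) -avgD.
  apply: le_avg => // r rV; rewrite -avgD -[X in X <= _](avg_cst tg).
  apply: le_avg => // f fB; rewrite -natrD ler_nat /dn.
  by case: eqVneq => [->|_] //=; rewrite (leq_trans (leq_b1 _)).
apply: (@le_trans _ _ (avg (through B) (fun f => (pos f != rank r0)%:R) +
   (avg (through B) (fun f => `|excess R k F f|) +
     avg (through B) (fun f => P (up f))))); last by lra.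
rewrite [X in _ + (_ + X)]avg_swap -[X in X + _](avg_cst V_gt0).
rewrite -[X in _ + (X + _)](avg_cst V_gt0) -!avgD.
apply: le_avg => // r rV; rewrite -!avgD -[X in X <= _](avg_cst tg).
apply: le_avg => // f fB.
have fM := through_max_chains fB.
have Bt : B \in trace F f by rewrite in_trace BF; move: fB; rewrite in_through => /andP[].
case: (boolP (low_at _ _ _ _)) => low; last by rewrite !addr_ge0 ?ler0n.
case: (eqVneq (pos f) (rank r0)) => [pr|_] /=; last first.
  by rewrite lerDl addr_ge0 ?ler0n.
case: (eqVneq #|trace F f| k.-1) => [tk|tk]; last first.
  by rewrite add0r (le_trans (excess_ge1 tk)) // lerDl ler0n.
(* With k - 1 members on the chain and [m] of them below [B], exactly k - 2 - m lie above. *)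
suff -> : up f r by rewrite add0r lerDr.
move: low; rewrite /up /low_at.
have ar := rank_arith_dual (card_trace_split fM Bt) tk.
by rewrite -pr => /orP[] /ar ->; rewrite ?orbT.
Qed.

End Rank.

Lemma dual_rank_arith (h m k : nat) : (h < k - 2 - m) = (h + m + 2 < k).
Proof. lia. Qed.

Lemma dual_rank_arith2 (h m k : nat) : m + 2 <= k -> (h + (k - 2 - m) + 2 < k) = (h < m).
Proof. lia. Qed.

Section DualAverages.
Local Open Scope ring_scope.
Variables (R : realType) (n : nat).
Implicit Types (F U : {set {set 'I_n}}) (A B : {set 'I_n}) (f : max_chain n).

Lemma chain_prob_dual B : chain_prob R (~: B) = chain_prob R B.
Proof.
rewrite /chain_prob cardsCs setCK card_ord bin_sub //.
by rewrite -ltnS card_lt.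
Qed.

Lemma big_dual U (X : {set 'I_n} -> R) :
  \sum_(A in dual U) X A = \sum_(A in U) X (~: A).
Proof. by rewrite big_imset //= => A B _ _; apply: setC_inj. Qed.

Lemma density_dual U : density R (dual U) = density R U.
Proof. by rewrite /density big_dual; apply: eq_bigr => B _; apply: chain_prob_dual. Qed.

Lemma chain_avg_dual (X : max_chain n -> R) :
  chain_avg (fun f => X (dual_chain f)) = chain_avg X.
Proof.
apply/esym; apply: avg_involutive; first exact: dual_chainK.
exact: dual_chain_in.
Qed.

Lemma excess_dual k F f : excess R k (dual F) (dual_chain f) = excess R k F f.
Proof. by rewrite /excess trace_dual card_dual. Qed.

End DualAverages.

(** * Combining the upward and downward bounds *)

Section EntropyBound.
Local Open Scope ring_scope.
Variables (R : realType) (n k : nat) (F : {set {set 'I_n}}).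
Variable V : {set {set {set 'I_n}}}.
Hypothesis V_gt0 : (0 < #|V|)%N.
Hypothesis k2 : (2 <= k)%N.
Hypothesis V_valid : forall r, r \in V -> valid_red k F r.
Variable zeta : R.
Hypotheses (zeta_gt0 : 0 < zeta) (zeta_k : 1000 * (zeta * k%:R) <= 1).
Hypothesis n_large : 160 * (1000 * (k%:R * log2 (k%:R : R))) <= zeta * n%:R.
Hypothesis kkn : (4 * k ^ 2 <= n)%N.
Implicit Types (A B : {set 'I_n}) (f : max_chain n) (r : {set {set 'I_n}}).

Let dF := dual F.
Let dV := dual_set V.
(** Chosen with [xi2] so that twice [kappa] * 2k plus [xi2] equals zeta / 80; [exists_rank] doubles
    this to the zeta / 40 required of a typical height. *)
Let kappa := zeta / (640 * k%:R).
Let xi2 := zeta / 160.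

Let kR : 2 <= k%:R :> R. Proof. by rewrite ler_nat. Qed.

Let kappa_k : kappa * (2 * k%:R) = zeta / 320.
Proof. by rewrite /kappa; field; rewrite gt_eqF //; move: kR; lra. Qed.

Let kappa_gt0 : 0 < kappa.
Proof. by rewrite divr_gt0 //; have := kR; lra. Qed.

Let dV_gt0 : (0 < #|dV|)%N.
Proof.
have [r rV] : exists r, r \in V by apply/card_gt0P.
by apply/card_gt0P; exists (dual r); rewrite in_dual_set.
Qed.

Let dV_valid r : r \in dV -> valid_red k dF r.
Proof. by rewrite -(dualK r) in_dual_set => /V_valid/dual_valid. Qed.

(* Members of [U1] pay for themselves. Those of [U2] pay through the conflicts at
   members of [U1] on the chains through them. *)
Let U1 := [set B in F | (kappa <= conflict_rate R F V B) ||
                        (kappa <= conflict_rate R dF dV (~: B))].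

Let con := conflicts_in R F V U1.
Let dcon f := conflicts_in R dF dV (dual U1) (dual_chain f).
Let anomaly f := `|excess R k F f| + con f + dcon f.
Let U2 := [set B in F | xi2 <= avg (through B) anomaly].
Let U := U1 :|: U2.

Let U1F : U1 \subset F. Proof. by apply/subsetP => B; rewrite inE => /andP[]. Qed.
Let U2F : U2 \subset F. Proof. by apply/subsetP => B; rewrite inE => /andP[]. Qed.
Let UF : U \subset F. Proof. by rewrite subUset U1F U2F. Qed.

Let trace_le f : f \in max_chains n -> (#|trace F f| <= 2 * k)%N.
Proof.
move=> fM; apply: leq_trans (card_trace_le V_gt0 k2 V_valid fM) _.
by rewrite mul2n leq_double leq_pred.
Qed.

Let dtrace_le f : f \in max_chains n -> (#|trace dF f| <= 2 * k)%N.
Proof.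
move=> fM; apply: leq_trans (card_trace_le dV_gt0 k2 dV_valid fM) _.
by rewrite mul2n leq_double leq_pred.
Qed.

Let anomaly_ge0 f : 0 <= anomaly f.
Proof. by rewrite /anomaly !addr_ge0 ?conflicts_in_ge0. Qed.

Let good m B := [&& (m + 2 <= k)%N, avg V (fun r => (low_at F B m r)%:R) <= zeta / 40 &
  avg V (fun r => (low_at dF (~: B) (k - 2 - m) (dual r))%:R) <= zeta / 40].

Let exists_good B : B \in F :\: U -> exists m : 'I_k, good m B.
Proof.
rewrite in_setD in_setU negb_or => /andP[/andP[B1 B2] BF].
have tg := through_gt0 B.
have below : conflicts_below R F V B <= avg (through B) con + kappa * (2 * k)%:R.
  apply: conflicts_below_le => //; first exact: ltW.
  move=> C; rewrite in_setD => /andP[+ CF]; rewrite inE CF negb_or -!ltNge.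
  by move=> /andP[/ltW].
have dbelow : conflicts_below R dF dV (~: B) <= avg (through B) dcon + kappa * (2 * k)%:R.
  rewrite -avg_through_dual; apply: conflicts_below_le => //.
  - by rewrite in_dual.
  - exact: ltW.
  move=> C; rewrite -(setCK C) in_setD !in_dual => /andP[+ CF].
  by rewrite inE CF negb_or -!ltNge => /andP[_ /ltW].
have le_e : avg (through B) (fun f => `|excess R k F f|) + conflicts_below R F V B
    + conflicts_below R dF dV (~: B) <= zeta / 80.
  have : avg (through B) anomaly < xi2 by move: B2; rewrite inE BF /= -ltNge.
  rewrite /anomaly !avgD; move: below dbelow; rewrite natrM kappa_k /xi2; lra.
have [m [m_k h1 h2]] := exists_rank V_gt0 V_valid BF le_e.
have mk : (m < k)%N by apply: leq_trans m_k; rewrite addn2 leqW.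
exists (Ordinal mk); rewrite /good /= m_k /=.
by apply/andP; split; [apply: le_trans h1 _|apply: le_trans h2 _]; lra.
Qed.

Let rk B : nat := if [pick m : 'I_k | good m B] is Some m then m else 0%N.

Let rk_good B : B \in F :\: U -> good (rk B) B.
Proof. by rewrite /rk => /exists_good[m0 gm0]; case: pickP => // /(_ m0); rewrite gm0. Qed.

Let n_large' : 160 * log2 (k%:R : R) <= zeta * n%:R.
Proof. by apply: le_trans n_large; have := log2_ge1 R k2; move: kR; nra. Qed.

Let bound_up := 8 * log2 (k%:R : R) / n%:R * density R U.

Let forward : log2 (#|V|%:R : R) <= (middle_levels_size n k)%:R +
  low_bin R n k * (- (2 / 5) * chain_avg (fun f => `|excess R k F f|)
    - 10^-1 * chain_avg (conflicts_in R F V U) + bound_up).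
Proof.
apply: (forward_bound V_gt0 k2 V_valid zeta_gt0 zeta_k n_large' kkn (rk := rk)).
  by move=> B /rk_good/and3P[_ h _].
move=> B /rk_good/and3P[_ _ h]; apply: le_trans h; rewrite le_eqVlt; apply/orP; left; apply/eqP.
by apply: eq_avg => r _; rewrite /low_at -dualD !dual_rank_arith.
Qed.

(** In the complemented family, k - 2 - [rk B] is the typical height of [~: B], and [rk_below] and
    [rk_above] exchange roles. *)
Let backward : log2 (#|V|%:R : R) <= (middle_levels_size n k)%:R +
  low_bin R n k * (- (2 / 5) * chain_avg (fun f => `|excess R k F f|)
    - 10^-1 * chain_avg (conflicts_in R dF dV (dual U)) + bound_up).
Proof.
have -> : #|V| = #|dV|.
  rewrite -(card_imset _ (inv_inj (@dualK n))); apply: eq_card => r.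
  by rewrite -[in RHS](dualK r) (mem_imset _ _ (inv_inj (@dualK n))) inE dualK.
have -> : chain_avg (fun f => `|excess R k F f|) = chain_avg (fun f => `|excess R k dF f|).
  by rewrite -[RHS]chain_avg_dual; apply: eq_avg => f _; rewrite excess_dual.
rewrite /bound_up -density_dual.
apply: (forward_bound dV_gt0 k2 dV_valid zeta_gt0 zeta_k n_large' kkn
  (rk := fun C => (k - 2 - rk (~: C))%N)) => B; rewrite -(setCK B);
  move: (~: B) => {}B; rewrite -dualD in_dual => /rk_good/and3P[mk h1 h2].
  by rewrite setCK avg_dual_set.
rewrite setCK avg_dual_set; apply: le_trans h1.
rewrite le_eqVlt; apply/orP; left; apply/eqP.
apply: eq_avg => r _; rewrite -dualD !dualK /low_at.
by rewrite ?setCK !dual_rank_arith2.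
Qed.

Let X := chain_avg (fun f => `|excess R k F f|).
Let G1 := chain_avg con.
Let D1 := chain_avg dcon.

Let anomalyE : chain_avg anomaly = X + G1 + D1.
Proof. by rewrite /chain_avg /anomaly !avgD. Qed.

Let conflicts_mono FF VV (U' U'' : {set {set 'I_n}}) : U' \subset U'' ->
  chain_avg (conflicts_in R FF VV U') <= chain_avg (conflicts_in R FF VV U'').
Proof.
move=> sub; apply: le_avg => [|f _]; first exact: max_chains_gt0.
apply: ler_sum => A _; case: next => // B.
case: (boolP (B \in U')) => [/(subsetP sub) -> //|_].
by case: ifP => // _; apply: prob_conflict_ge0.
Qed.

Let density_U1 : kappa * density R U1 <= G1 + D1.
Proof.
have -> : G1 = \sum_(B in U1) chain_prob R B * conflict_rate R F V B.
  exact: chain_avg_conflicts_in.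
have -> : D1 = \sum_(B in U1) chain_prob R B * conflict_rate R dF dV (~: B).
  rewrite /D1 /dcon (chain_avg_dual (conflicts_in R dF dV (dual U1))).
  rewrite chain_avg_conflicts_in ?dual_sub // big_dual.
  by apply: eq_bigr => B _; rewrite chain_prob_dual.
rewrite -big_split /density mulr_sumr /=; apply: ler_sum => B.
have c0 := chain_prob_gt0 R B.
have r0 : 0 <= conflict_rate R F V B.
  apply: divr_ge0; last exact: ltW.
  by apply: avg_ge0 => f _; apply: conflict_at_ge0.
have r1 : 0 <= conflict_rate R dF dV (~: B).
  apply: divr_ge0; last exact: ltW (chain_prob_gt0 R _).
  by apply: avg_ge0 => f _; apply: conflict_at_ge0.
rewrite inE => /andP[_ h]; rewrite -mulrDr mulrC ler_pM2l //.
by case/orP: h => h; lra.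
Qed.

(** Markov's inequality at each member, then double counting: the anomaly of a chain is charged once
    per member it meets, at most 2k times. *)
Let density_U2 : xi2 * density R U2 <= 2 * k%:R * (X + G1 + D1).
Proof.
have M0 : 0 < #|max_chains n|%:R :> R by rewrite ltr0n max_chains_gt0.
rewrite -anomalyE -natrM -avgZ.
apply: (@le_trans _ _ (chain_avg (fun f => \sum_(A in trace F f) anomaly f))); last first.
  apply: le_avg => [|f fM]; first exact: max_chains_gt0.
  rewrite sumr_const -[X in X <= _]mulr_natl; apply: ler_wpM2r; first exact: anomaly_ge0.
  by rewrite ler_nat trace_le.
rewrite chain_avg_trace /density mulr_sumr.
apply: (@le_trans _ _ (\sum_(A in U2) #|max_chains n|%:R^-1 * \sum_(f in through A) anomaly f)).
  apply: ler_sum => B; rewrite inE => /andP[_].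
  rewrite /avg chain_probE => h; rewrite mulrA mulrC ler_pM2l ?invr_gt0 //.
  have t0 : 0 < #|through B|%:R :> R by rewrite ltr0n through_gt0.
  by move: h; rewrite mulrC ler_pdivlMr.
rewrite [X in _ <= X](bigID (fun A => A \in U2)) /= -[X in X <= _]addr0; apply: lerD.
  rewrite le_eqVlt; apply/orP; left; apply/eqP; apply: eq_bigl => A.
  by apply/esym; apply: andb_idl => /(subsetP U2F).
by apply: sumr_ge0 => A _; rewrite mulr_ge0 ?invr_ge0 ?ler0n ?sumr_ge0.
Qed.

(** Adding the bounds for [U1] and [U2] gives zeta * density U <= (640 + 320) k (X + G1 + D1). The
    resulting factor 8 * 960 * 20 is below the 160 * 1000 of [n_large]. *)
Let density_U : bound_up <= (X + G1 + D1) / 20.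
Proof.
have n0 : 0 < n%:R :> R.
  rewrite ltr0n (leq_trans _ kkn) // muln_gt0 expn_gt0 /=.
  by rewrite (leq_trans _ k2).
have lg := log2_ge1 R k2.
have alpha0 : 0 <= X + G1 + D1 by rewrite -anomalyE; apply: avg_ge0.
have dU : density R U <= density R U1 + density R U2.
  rewrite /density [X in X <= _](bigID (fun A => A \in U1)) /=; apply: lerD.
    rewrite le_eqVlt; apply/orP; left; apply/eqP; apply: eq_bigl => A.
    by rewrite in_setU; case: (A \in U1); rewrite ?andbT ?andbF.
  rewrite [X in X <= _]big_mkcond [X in _ <= X]big_mkcond /=; apply: ler_sum => A _.
  have := ltW (chain_prob_gt0 R A); rewrite in_setU.
  by case: (A \in U1); case: (A \in U2).
have k0 : 0 < k%:R :> R by move: kR; lra.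
have d : zeta * density R U <= 960 * k%:R * (X + G1 + D1).
  have h1 : zeta * density R U1 <= 640 * k%:R * (G1 + D1).
    have -> : zeta * density R U1 = 640 * k%:R * (kappa * density R U1).
      by rewrite /kappa; field; rewrite gt_eqF //; move: kR; lra.
    by rewrite ler_pM2l ?mulr_gt0.
  have h2 : zeta * density R U2 <= 320 * k%:R * (X + G1 + D1).
    have -> : zeta * density R U2 = 160 * (xi2 * density R U2) by rewrite /xi2; field.
    have := density_U2; lra.
  have X0 : 0 <= X by apply: avg_ge0 => f _; apply: normr_ge0.
  have h3 : zeta * density R U <= zeta * (density R U1 + density R U2) by rewrite ler_pM2l.
  have h4 : 0 <= k%:R * X by rewrite mulr_ge0 ?ler0n.
  move: h1 h2 h3; rewrite -!mulrA !mulrDr; lra.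
rewrite /bound_up mulrAC ler_pdivrMr // -(ler_pM2l zeta_gt0).
have -> : zeta * (8 * log2 k%:R * density R U) = 8 * log2 (k%:R : R) * (zeta * density R U) by ring.
apply: (@le_trans _ _ (8 * log2 (k%:R : R) * (960 * k%:R * (X + G1 + D1)))).
  by rewrite ler_pM2l //; lra.
have -> : 8 * log2 (k%:R : R) * (960 * k%:R * (X + G1 + D1)) =
  (8 * 960 * 20) * (k%:R * log2 (k%:R : R)) * ((X + G1 + D1) / 20) by field.
have -> : zeta * ((X + G1 + D1) / 20 * n%:R) = zeta * n%:R * ((X + G1 + D1) / 20) by ring.
apply: ler_wpM2r; first by rewrite divr_ge0.
apply: le_trans n_large.
have : 0 <= k%:R * log2 (k%:R : R) by rewrite mulr_ge0 ?ler0n //; lra.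
lra.
Qed.

Lemma entropy_bound : log2 (#|V|%:R : R) <= (middle_levels_size n k)%:R -
  3^-1 * (low_bin R n k * chain_avg (fun f => `|excess R k F f|)).
Proof.
have kn : (k <= n)%N.
  by apply: leq_trans kkn; rewrite mulnCA leq_pmulr // muln_gt0 /= (leq_trans _ k2).
have mu0 := low_bin_gt0 R k2 kn.
have X0 : 0 <= X by apply: avg_ge0 => f _; apply: normr_ge0.
have g : G1 <= chain_avg (conflicts_in R F V U) by apply: conflicts_mono; rewrite subsetUl.
have d : D1 <= chain_avg (conflicts_in R dF dV (dual U)).
  rewrite /D1 /dcon (chain_avg_dual (conflicts_in R dF dV (dual U1))).
  by apply: conflicts_mono; rewrite dual_sub subsetUl.
have := density_U; move: forward backward; rewrite -/X => fw bw du.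
(* Twice [bound_up] is at most (X + G1 + D1) / 10: the conflict terms cancel, and -4/5 + 1/10 =
   -7/10 remains of [X]. *)
have : low_bin R n k * ((- (2 / 5) * X - 10^-1 * chain_avg (conflicts_in R F V U) + bound_up)
   + (- (2 / 5) * X - 10^-1 * chain_avg (conflicts_in R dF dV (dual U)) + bound_up)) <=
   low_bin R n k * (- (2 / 3) * X).
  by rewrite ler_pM2l //; lra.
by move: fw bw; rewrite mulrDr; lra.
Qed.

End EntropyBound.

(** * Colourings and chain-free families *)

Section Colourings.
Variables (n k : nat) (F : {set {set 'I_n}}).
Hypothesis k2 : 2 <= k.
Implicit Types (A B : {set 'I_n}) (r G : {set {set 'I_n}}).

Let k0 : 0 < k. Proof. exact: leq_trans k2. Qed.

Definition valid_reds := [set r | valid_red k F r].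

Definition colouring_of r : {ffun member F -> 'I_2} :=
  [ffun x => if val x \in r then ord0 else ord_max].

Definition red_of (c : {ffun member F -> 'I_2}) : {set {set 'I_n}} :=
  val @: [set x | c x == ord0].

Lemma red_of_sub c : red_of c \subset F.
Proof. by apply/subsetP => _ /imsetP[x _ ->]; apply: valP. Qed.

Lemma in_red_of c x : (val x \in red_of c) = (c x == ord0).
Proof. by rewrite mem_imset ?inE //; apply: val_inj. Qed.

Lemma colouring_ofK c : colouring_of (red_of c) = c.
Proof.
apply/ffunP => x; rewrite ffunE in_red_of.
case: eqP => [-> //|]; case: (c x) => [[|[|i]] ci] //= ne.
  by case: ne; apply: val_inj.
exact: val_inj.
Qed.

Lemma colouring_of_inj : {in valid_reds &, injective colouring_of}.
Proof.
move=> r r'; rewrite !inE => /and3P[rF _ _] /and3P[r'F _ _] /ffunP e.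
apply/setP => A; case: (boolP (A \in F)) => AF; last first.
  by rewrite (negbTE (contra (subsetP rF A) AF)) (negbTE (contra (subsetP r'F A) AF)).
have := e (exist _ A AF); rewrite !ffunE /=.
by case: (A \in r); case: (A \in r').
Qed.

Lemma lift_member (t : seq {set 'I_n}) : all [in F] t ->
  exists s : seq (member F), map val s = t.
Proof.
elim: t => [|A t IH] /=; first by exists [::].
by move=> /andP[AF /IH[s <-]]; exists (exist _ A AF :: s).
Qed.

Lemma is_colouring_of r : r \subset F ->
  is_colouring k (colouring_of r) = chain_free k r && chain_free k (F :\: r).
Proof.
move=> rF; rewrite /is_colouring /chain_free -negb_or; congr (~~ _).
have to_mono G v : G \subset F ->
    (forall x : member F, val x \in G -> colouring_of r x = v) ->
    [exists s : k.-tuple {set 'I_n}, is_chain s && all [in G] s] ->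
    [exists s : k.-tuple (member F),
        is_chain [tuple of map val s] && constant (map (colouring_of r) s)].
  move=> GF Gv /existsP[t /andP[ch tG]].
  have [|s es] := @lift_member t; first by apply/allP => A /(allP tG)/(subsetP GF).
  have sk : size s == k by rewrite -(size_map val) es size_tuple.
  apply/existsP; exists (Tuple sk); apply/andP; split.
    by move: ch; rewrite /is_chain /= es.
  apply: (@all_pred1_constant _ v).
  rewrite all_map; apply/allP => x xs /=; apply/eqP/Gv.
  by apply: (allP tG); rewrite -es map_f.
apply/idP/orP => [/existsP[[s sk] /andP[]]|[]].
- rewrite /is_chain /=; case: s sk => [|x s] sk ch mono.
    by move: sk k0 => /= /eqP <-.
  have all_x : all (fun y => colouring_of r y == colouring_of r x) (x :: s).
    by rewrite /= eqxx /=; move: mono => /=; rewrite all_map.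
  have tk : size (map val (x :: s)) == k by rewrite size_map.
  case: (boolP (val x \in r)) => xr; [left|right]; apply/existsP; exists (Tuple tk).
    move: ch; rewrite /is_chain /= => -> /=.
    move: all_x; rewrite /= ffunE xr /= => al; rewrite all_map.
    by apply: sub_all al => y /=; rewrite ffunE; case: ifP.
  move: ch; rewrite /is_chain /= => -> /=.
  move: all_x; rewrite /= ffunE (negbTE xr) in_setD xr (valP x) /= => al; rewrite all_map.
  by apply: sub_all al => y /=; rewrite ffunE in_setD (valP y) andbT; case: ifP.
- by apply: (to_mono _ ord0) => // x xr; rewrite ffunE xr.
- apply: (to_mono _ ord_max); first exact: subsetDl.
  by move=> x; rewrite in_setD ffunE => /andP[/negbTE -> _].
Qed.

Lemma num_colouringsE : num_colourings 2 k F = #|valid_reds|.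
Proof.
rewrite /num_colourings -(card_in_imset colouring_of_inj); apply: eq_card => c.
rewrite inE; apply/idP/imsetP => [ic|[r + ->]].
  exists (red_of c); last by rewrite colouring_ofK.
  rewrite inE /valid_red red_of_sub -!chain_freeE // -is_colouring_of ?red_of_sub //.
  by rewrite colouring_ofK.
by rewrite inE => /and3P[rF lR lB]; rewrite is_colouring_of // !chain_freeE ?lR.
Qed.

Lemma low_heights_sub G G' : G \subset G' -> low_heights k G' -> low_heights k G.
Proof.
move=> GG' lG'; rewrite -chain_freeE //; move: lG'; rewrite -chain_freeE //.
apply: contra => /existsP[s /andP[ch sG]]; apply/existsP; exists s; rewrite ch /=.
by apply: sub_all sG => A; apply: (subsetP GG').
Qed.

Lemma card_valid_reds_le : #|valid_reds| <= 2 ^ #|F|.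
Proof.
rewrite -card_powerset; apply: subset_leq_card; apply/subsetP => r.
by rewrite !inE => /and3P[].
Qed.

(** If all subsets are valid red sets, [F] itself is one and so is chain-free; conversely
    chain-freeness passes to subfamilies. *)
Lemma card_valid_reds_eq : (#|valid_reds| == 2 ^ #|F|) = low_heights k F.
Proof.
have sub : valid_reds \subset powerset F.
  by apply/subsetP => r; rewrite !inE => /and3P[].
apply/eqP/idP => [e|lF].
  have /eqP eV : valid_reds == powerset F by rewrite eqEcard sub card_powerset e leqnn.
  have : F \in valid_reds by rewrite eV inE.
  by rewrite inE => /and3P[].
rewrite -card_powerset; apply: eq_card => r; rewrite !inE /valid_red.
case: (boolP (r \subset F)) => //= rF.
by rewrite !(low_heights_sub _ lF) ?subsetDl.
Qed.

End Colourings.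

(** * Maximum chain-free families *)

Section Erdos.
Variables (n k : nat).
Hypotheses (k2 : 2 <= k) (kn : k <= n).
Implicit Types (A B : {set 'I_n}) (G : {set {set 'I_n}}).

Lemma card_trace_low G f : f \in max_chains n -> low_heights k G -> #|trace G f| <= k.-1.
Proof.
move=> fM /forallP lG; rewrite -sum1_card.
apply: (@trace_potential_top _ _ _ (height G)) => // A At.
have AG : A \in G by move: At; rewrite in_trace => /andP[].
rewrite addn1; case e : (next G f A) => [B|]; last by have := lG A; rewrite AG /=; case: (k).
by have [_ AB] := next_trace fM e; apply: height_lt.
Qed.

Lemma card_le_excess (R : realType) G : (#|G|%:R <= (middle_levels_size n k)%:R +
  low_bin R n k * chain_avg (excess R k G))%R.
Proof.
have -> : (#|G|%:R = chain_avg (fun f => \sum_(A in trace G f) 'C(n, #|A|)%:R * 1) :> R)%R.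
  rewrite chain_avg_trace_cst -sum1_card natr_sum; apply: eq_bigr => A _.
  by rewrite mulr1 mulVf // gt_eqF // bin_card_gt0.
have M0 := max_chains_gt0 n.
rewrite -[X in (_ <= X + _)%R](avg_cst M0) -avgZ -avgD; apply: le_avg => // f fM.
apply: le_trans (trace_weight k2 kn fM (w := fun=> 1%R) _) _.
  by move=> A _; rewrite ler01 lexx.
by rewrite sumr_const.
Qed.

(** Erdos's theorem: a chain-free family has nonpositive excess on every maximal chain. *)
Lemma erdos_bound (R : realType) G : low_heights k G -> #|G| <= middle_levels_size n k.
Proof.
move=> lG; rewrite -(ler_nat R); apply: le_trans (card_le_excess R G) _.
rewrite gerDl mulr_ge0_le0 ?(ltW (low_bin_gt0 R k2 kn)) //.
have M0 := max_chains_gt0 n.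
rewrite -(avg_cst M0 0%R); apply: le_avg => // f fM.
by rewrite /excess subr_le0 ler_nat card_trace_low.
Qed.

Definition middle_levels : {set {set 'I_n}} :=
  [set A : {set 'I_n} | low_level n k <= #|A| < ((n + k - 2) %/ 2).+1].

Lemma card_middle_levels : #|middle_levels| = middle_levels_size n k.
Proof.
rewrite /middle_levels_size -(sum_window k2 kn (T := nat) (fun i => 'C(n, i))).
rewrite -sum1_card (partition_big (fun A : {set 'I_n} => inord #|A| : 'I_n.+1)
  (fun i : 'I_n.+1 => low_level n k <= i < ((n + k - 2) %/ 2).+1)) /=; last first.
  by move=> A; rewrite inE inordK // card_lt.
apply: eq_bigr => i wi; rewrite sum1dep_card -[X in 'C(X, _)](card_ord n) -card_draws.
apply: eq_card => A; rewrite !inE; apply/andP/eqP => [[_ /eqP <-]|cA].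
  by rewrite inordK // card_lt.
  by rewrite cA inord_val wi; split.
Qed.

Lemma low_heights_middle_levels : low_heights k middle_levels.
Proof.
apply/forallP => A; apply/implyP; rewrite inE => /andP[loA Ahi].
have lev B : B \in middle_levels -> low_level n k <= #|B| by rewrite inE => /andP[].
have h := height_leq_card lev loA.
have := window_size k2 kn; move: h loA Ahi k2.
by move: (height _ _) #|A| ((n + k - 2) %/ 2).+1 (low_level n k) => a b c d; clear; lia.
Qed.

Lemma max_chain_freeE (R : realType) G :
  max_chain_free k G <-> low_heights k G /\ #|G| = middle_levels_size n k.
Proof.
have k0 : 0 < k by apply: leq_trans k2.
rewrite /max_chain_free; split=> -[cf h]; move: (cf); rewrite chain_freeE // => lG.
  split => //; apply/eqP; rewrite eqn_leq (erdos_bound R lG) -card_middle_levels h //.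
  by rewrite chain_freeE // low_heights_middle_levels.
by split => // G'; rewrite chain_freeE // h => /(erdos_bound R).
Qed.

End Erdos.

(** * The bound on colourings and its equality case *)

Section Main.
Variables (R : realType) (n k : nat).
Hypothesis k2 : 2 <= k.
Hypothesis n_large :
  (160 * (1000 * 1000) * k%:R ^+ 4 * log2 (k%:R : R) <= n%:R)%R.

Let kR : (2 <= k%:R :> R)%R. Proof. by rewrite ler_nat. Qed.

Let kkn : 4 * k ^ 2 <= n.
Proof.
rewrite -(ler_nat R) natrM natrX; apply: le_trans n_large.
have lg := log2_ge1 R k2.
have : (k%:R ^+ 2 <= k%:R ^+ 4 :> R)%R by apply: ler_weXn2l => //; move: kR; lra.
have : (0 <= k%:R ^+ 4 :> R)%R by rewrite exprn_ge0.
move: (_ ^+ 4)%R (_ ^+ 2)%R lg; move: (log2 _) => l a b lg a0 ab.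
have : (a <= a * l)%R by rewrite ler_peMr.
lra.
Qed.

Let kn : k <= n.
Proof.
by apply: leq_trans kkn; rewrite mulnCA leq_pmulr // muln_gt0 /= (leq_trans _ k2).
Qed.

Lemma num_colourings_entropy (F : {set {set 'I_n}}) : 0 < num_colourings 2 k F ->
  (log2 ((num_colourings 2 k F)%:R : R) <= (middle_levels_size n k)%:R -
  3^-1 * (low_bin R n k * chain_avg (fun f => `|excess R k F f|)))%R.
Proof.
rewrite num_colouringsE // => V0.
have k0 : (0 < k%:R :> R)%R by move: kR; lra.
(* The value 1 / (1000 k) is the largest that [zeta_k] allows for [zeta]. *)
apply: (@entropy_bound R n k F (valid_reds k F) V0 k2 _ (1000 * k%:R)^-1) => //.
- by move=> r; rewrite inE.
- by rewrite invr_gt0 mulr_gt0 // ltr0n.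
- by rewrite le_eqVlt; apply/orP; left; apply/eqP; field; rewrite gt_eqF.
rewrite [X in (_ <= X)%R]mulrC ler_pdivlMr; last by apply: mulr_gt0 => //; rewrite ltr0n.
apply: le_trans n_large.
have lg := log2_ge1 R k2.
have : (k%:R ^+ 2 <= k%:R ^+ 4 :> R)%R by apply: ler_weXn2l => //; move: kR; lra.
have -> : (160 * (1000 * (k%:R * log2 (k%:R : R))) * (1000 * k%:R) =
   160 * (1000 * 1000) * k%:R ^+ 2 * log2 (k%:R : R))%R by ring.
move=> le; apply: ler_wpM2r; first lra.
by apply: ler_wpM2l => //; rewrite !mulr_ge0 ?ler0n.
Qed.

Lemma colouring_bound (F : {set {set 'I_n}}) :
  num_colourings 2 k F <= 2 ^ middle_levels_size n k /\
  (num_colourings 2 k F = 2 ^ middle_levels_size n k <-> max_chain_free k F).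
Proof.
set m := middle_levels_size n k; set N := num_colourings 2 k F.
have log2_pow : (log2 ((2 ^ m)%:R : R) = m%:R)%R.
  by rewrite natrX log2X // log2_2 mulr1.
have pow0 : (0 < (2 ^ m)%:R :> R)%R by rewrite ltr0n expn_gt0.
have mu0 := low_bin_gt0 R k2 kn.
have ex0 : (0 <= chain_avg (fun f => `|excess R k F f|) :> R)%R.
  by apply: avg_ge0 => f _; apply: normr_ge0.
have cost0 : (0 <= low_bin R n k * chain_avg (fun f => `|excess R k F f|))%R.
  by rewrite mulr_ge0 // ltW.
split.
  case: (posnP N) => [-> //|N0]; rewrite -(ler_nat R) -log2_le ?ltr0n ?expn_gt0 // log2_pow.
  have := num_colourings_entropy N0; rewrite -/N -/m; lra.
rewrite (max_chain_freeE k2 kn R).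
have NE : N = #|valid_reds k F| by rewrite /N num_colouringsE.
split=> [eN|[lF cF]]; last first.
  by move: lF; rewrite -card_valid_reds_eq // => /eqP eV; rewrite NE eV cF.
have N0 : 0 < N by rewrite eN expn_gt0.
have := num_colourings_entropy N0; rewrite -/N -/m eN log2_pow => le.
(* Equality leaves no room for any excess, so |F| <= m. Since N <= 2^|F|, also |F| >= m, and then
   every subset of [F] is a valid red set. *)
have ex_eq0 : (chain_avg (fun f => `|excess R k F f|) = 0 :> R)%R.
  have : (low_bin R n k * chain_avg (fun f => `|excess R k F f|) <= 0)%R by lra.
  by rewrite pmulr_rle0 // => ex_le0; apply/le_anti/andP.
have cF : #|F| <= m.
  rewrite -(ler_nat R); apply: le_trans (card_le_excess k2 kn R F) _.
  rewrite gerDl pmulr_rle0 // -ex_eq0; apply: le_avg; first exact: max_chains_gt0.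
  by move=> f _; apply: ler_norm.
have le_pow : 2 ^ m <= 2 ^ #|F| by rewrite -eN NE card_valid_reds_le.
rewrite leq_exp2l // in le_pow.
have eF : #|F| = m by apply/eqP; rewrite eqn_leq cF.
by split => //; rewrite -card_valid_reds_eq // -NE eN eF.
Qed.

End Main.

Theorem theorem1p2 (R : realType) :
  exists C : R, (0 < C)%R /\
    forall n k : nat, 2 <= k ->
      (C * k%:R ^+ 4 * log2 (k%:R : R) <= n%:R)%R ->
      forall F : {set {set 'I_n}},
        num_colourings 2 k F <= 2 ^ middle_levels_size n k /\
        (num_colourings 2 k F = 2 ^ middle_levels_size n k <->
         max_chain_free k F).
Proof.
exists (160 * (1000 * 1000))%R; split=> [|n k k2 n_large F]; last exact: colouring_bound n_large F.
by rewrite !mulr_gt0 ?ltr0n.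
Qed.
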